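(* Let $k\ge 2$, let $\pi\in S_k$, let $A\subseteq\{1,\dots,k-1\}$, and let $j=k-|A|$ be the number of blocks of the vincular pattern $(\pi,A)$. For each $n$ let $\sigma_n$ be a uniformly random element of $S_n$ and let $X^{(\pi,A)}(\sigma_n)$ be the number of occurrences of $(\pi,A)$ in $\sigma_n$. Then there exists a constant $C>0$ such that $$\operatorname{Var}\bigl(X^{(\pi,A)}(\sigma_n)\bigr)\sim C\,n^{2j-1}\quad\text{as } n\to\infty,$$ i.e. $\lim_{n\to\infty}\operatorname{Var}(X^{(\pi,A)}(\sigma_n))/(Cn^{2j-1})=1$.
   Context: $S_n$ is the set of permutations of $\{1,\dots,n\}$, written in one-line notation $\sigma=\sigma_1\sigma_2\dots\sigma_n$. A vincular pattern of size $k$ is a pair $(\pi,A)$ with $\pi\in S_k$ and $A\subseteq\{1,\dots,k-1\}$; its number of blocks is $j=k-|A|$. An occurrence of $(\pi,A)$ in $\sigma\in S_n$ is a subsequence $\sigma_{i_1}\sigma_{i_2}\dots\sigma_{i_k}$ with $i_1<i_2<\dots<i_k$ (identified with its set of positions $\{i_1,\dots,i_k\}$) such that (i) for all $r,s\in\{1,\dots,k\}$, $\pi_r<\pi_s \iff \sigma_{i_r}<\sigma_{i_s}$; and (ii) $i_{a+1}=i_a+1$ for all $a\in A$. *)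

(* Defs.v *)
From HB Require Import structures.
From mathcomp Require Import all_boot all_order all_fingroup all_algebra.
From mathcomp Require Import classical_sets reals topology normedtype.

Set Implicit Arguments.
Unset Strict Implicit.
Unset Printing Implicit Defensive.

Import Order.TTheory GRing.Theory Num.Theory.
Import numFieldNormedType.Exports.

Local Open Scope ring_scope.

(* Indices, positions and values are numbered from 0: a permutation of
   {1, ..., n} is an element of 'S_n, the permutations of 'I_n, and
   A \subseteq {1, ..., k-1} is a set over 'I_k.-1, where a \in A asks that
   the entries of the occurrence indexed by a and a+1 be adjacent. *)
Section VincularPattern.
Variables (k : nat) (pi : 'S_k) (A : {set 'I_k.-1}).

Definition blocks : nat := (k - #|A|)%N.

(* i is the increasing enumeration of a set of k positions. *)
Definition is_occurrence (n : nat) (sigma : 'S_n)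
    (i : {ffun 'I_k -> 'I_n}) : bool :=
  [&& [forall r : 'I_k, forall s : 'I_k, (r < s)%N ==> (i r < i s)%N],
      [forall r : 'I_k, forall s : 'I_k, (pi r < pi s)%N == (sigma (i r) < sigma (i s))%N] &
      [forall a in A, forall r : 'I_k, forall s : 'I_k,
         (r == a :> nat) && (s == a.+1 :> nat) ==> (i s == (i r).+1 :> nat)]].

Definition occurrences (n : nat) (sigma : 'S_n) : nat :=
  #|[set i : {ffun 'I_k -> 'I_n} | is_occurrence sigma i]|.

End VincularPattern.

Section UniformMoments.
Variables (R : realType) (T : finType).

Definition unif_mean (X : T -> R) : R := (\sum_(t : T) X t) / #|T|%:R.

Definition unif_var (X : T -> R) : R :=
  unif_mean (fun t => (X t - unif_mean X) ^+ 2).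

End UniformMoments.

(* Main.v *)
(* Expand the variance as a sum of covariances over pairs of position sets.
   Disjoint pairs contribute 0, and the covariance of an overlapping pair depends
   only on how the two sets interleave; for each interleaving the number of pairs
   is a binomial coefficient 'C(n - t, d) with d <= 2j - 1.  Hence
   Var(X) / n^(2j - 1) converges, and it remains to see that the limit is positive,
   which may be tested along a subsequence n = Q N.  There we use
   Var(X) >= 2 lam E[X Y] - lam^2 E[Y^2] with a centred test variable Y such that
   E[Y^2] = O(n) and E[X Y] is at least of order n^j.
   - If j >= 2, one of the two extreme blocks does not contain the position r0 of
     the minimum of pi.  Y counts (up to sign) the positions among the N extreme
     ones at that end that carry one of the N smallest values: an occurrence having
     its extreme entry there rarely also has there its minimum, so the small values
     at that end are too rare within occurrences, and X and Y are correlated.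
   - If j = 1, cut the positions into windows of length 3k.  Y is the sum over the
     windows of 1[tau] - 1[tau'], where tau' is a monotone order different from pi
     and tau is obtained from it by rearranging the middle third into a copy of pi.
     Passing from tau' to tau only changes occurrences inside the window, and there
     are none of them in tau'. *)

Require Import Defs.
From HB Require Import structures.
From mathcomp Require Import all_boot all_order all_fingroup all_algebra.
From mathcomp Require Import classical_sets reals topology normedtype.
From mathcomp Require Import boolp sequences.
From mathcomp Require Import fintype finset zify ring lra.

Set Implicit Arguments.
Unset Strict Implicit.
Unset Printing Implicit Defensive.

Import Order.TTheory GRing.Theory Num.Theory.
Import numFieldNormedType.Exports.

Local Open Scope ring_scope.

(** * Means and variances under the uniform distribution *)

Lemma sumr_cst (R : pzRingType) (I : finType) (A : pred I) (x : R) :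
  \sum_(i in A) x = #|A|%:R * x.
Proof. by rewrite sumr_const mulr_natl. Qed.

Section Mean.
Variables (R : realType) (T : finType).
Implicit Types X Y : T -> R.
Local Notation E := (@unif_mean R T).

Lemma eq_mean X Y : X =1 Y -> E X = E Y.
Proof. by move=> eqXY; congr (_ / _); apply: eq_bigr => t _; apply: eqXY. Qed.

Lemma meanD X Y : E (fun t => X t + Y t) = E X + E Y.
Proof. by rewrite /unif_mean big_split mulrDl. Qed.

Lemma meanZ a X : E (fun t => a * X t) = a * E X.
Proof. by rewrite /unif_mean -mulr_sumr mulrA. Qed.

Lemma meanB X Y : E (fun t => X t - Y t) = E X - E Y.
Proof. by rewrite /unif_mean sumrB mulrBl. Qed.

Lemma mean_sum (I : finType) (P : pred I) (F : I -> T -> R) :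
  E (fun t => \sum_(i | P i) F i t) = \sum_(i | P i) E (F i).
Proof. by rewrite /unif_mean exchange_big mulr_suml. Qed.

Lemma mean_le X Y : (forall t, X t <= Y t) -> E X <= E Y.
Proof.
move=> leXY; rewrite ler_wpM2r ?invr_ge0 ?ler0n //.
by apply: ler_sum => t _; apply: leXY.
Qed.

Lemma mean_bij (h : T -> T) X : injective h -> E (fun t => X (h t)) = E X.
Proof. by move=> h_inj; congr (_ / _); rewrite [RHS](reindex_inj h_inj). Qed.

Hypothesis T_gt0 : (0 < #|T|)%N.

Lemma mean_cst a : E (fun=> a) = a.
Proof.
by rewrite /unif_mean sumr_const -[a *+ _]mulr_natr mulfK // pnatr_eq0 -lt0n.
Qed.

Lemma varE X : unif_var X = E (fun t => X t * X t) - E X * E X.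
Proof.
rewrite /unif_var; set m := E X.
rewrite (@eq_mean _ (fun t => X t * X t - 2 * m * X t + m ^+ 2)); last first.
  by move=> t; ring.
by rewrite meanD meanB meanZ mean_cst -/m; ring.
Qed.

(** Take the mean of [(X - m - lam * Y) ^+ 2 >= 0], with [m] the mean of [X]; as [Y] is centred,
    subtracting [m] from [X] does not change the mixed term. *)
Lemma var_ge X Y lam : E Y = 0 ->
  2 * lam * E (fun t => X t * Y t) - lam ^+ 2 * E (fun t => Y t * Y t)
    <= unif_var X.
Proof.
move=> EY0; rewrite /unif_var; set m := E X.
have -> : E (fun t => X t * Y t) = E (fun t => (X t - m) * Y t).
  by under [RHS]eq_mean do rewrite mulrBl; rewrite meanB meanZ EY0 mulr0 subr0.
rewrite -!meanZ -meanB; apply: mean_le => t.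
by have := sqr_ge0 (X t - m - lam * Y t); lra.
Qed.

End Mean.

(** * Relative orders *)

Section Patterns.
Variable R : realType.

(** The map [e] is arbitrary, so that one predicate serves for occurrences, for unions of two
    occurrences and for windows, and also for patterns inside a pattern. *)
Definition pat (l n : nat) (rho : 'S_l) (sigma : 'S_n) (e : {ffun 'I_l -> 'I_n})
  : bool :=
  [forall r, forall s, (rho r < rho s)%N == (sigma (e r) < sigma (e s))%N].

Lemma patP l n (rho : 'S_l) (sigma : 'S_n) (e : {ffun 'I_l -> 'I_n}) :
  reflect (forall r s, (rho r < rho s)%N = (sigma (e r) < sigma (e s))%N)
          (pat rho sigma e).
Proof.
apply: (iffP forallP) => [H r s|H r]; first by have /forallP/(_ s)/eqP := H r.
by apply/forallP => s; rewrite H.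
Qed.

Lemma card_lt_perm l (rho : 'S_l) N : (N <= l)%N ->
  #|[set s | (rho s < N)%N]| = N.
Proof.
move=> Nl; have -> : [set s | (rho s < N)%N] = rho @^-1: [set x : 'I_l | (x < N)%N].
  by apply/setP => s; rewrite !inE.
rewrite card_preimset; last exact: perm_inj.
rewrite -sum1_card (eq_bigl (fun x : 'I_l => (x < N)%N)); last by move=> x; rewrite inE.
by rewrite (big_ord_narrow Nl) sum1_card card_ord.
Qed.

(** The value [rho r] is the number of [s] with [rho s < rho r], and these comparisons are dictated
    by [sigma] and [e]. *)
Lemma pat_uniq l n (rho rho' : 'S_l) (sigma : 'S_n) e :
  pat rho sigma e -> pat rho' sigma e -> rho = rho'.
Proof.
move=> /patP H /patP H'; apply/permP => r; apply/val_inj => /=.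
rewrite -(card_lt_perm rho (ltnW (ltn_ord (rho r)))).
rewrite -(card_lt_perm rho' (ltnW (ltn_ord (rho' r)))).
by apply: eq_card => s; rewrite !inE H H'.
Qed.

Lemma pat_ex l n (sigma : 'S_n) (e : {ffun 'I_l -> 'I_n}) :
  injective e -> exists rho : 'S_l, pat rho sigma e.
Proof.
move=> e_inj.
pose c r := #|[set s | (sigma (e s) < sigma (e r))%N]|.
have c_lt r : (c r < l)%N.
  rewrite -[X in (_ < X)%N]card_ord; apply/proper_card/properP; split.
    by apply/subsetP.
  by exists r => //; rewrite inE ltnn.
have c_mono r s : (sigma (e r) < sigma (e s))%N -> (c r < c s)%N.
  move=> lt_rs; apply/proper_card/properP; split.
    by apply/subsetP => x; rewrite !inE => /ltn_trans; apply.
  by exists r; rewrite !inE ?ltnn.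
have c_iff r s : (c r < c s)%N = (sigma (e r) < sigma (e s))%N.
  apply/idP/idP; last exact: c_mono.
  apply: contraTT; rewrite -!leqNgt leq_eqVlt => /orP[/eqP eq_rs|/c_mono /ltnW//].
  by have /perm_inj/e_inj -> := val_inj eq_rs.
have c_inj : injective (fun r => Ordinal (c_lt r)).
  move=> r s [eq_c]; apply: e_inj; apply: (@perm_inj _ sigma); apply/val_inj.
  by case: (ltngtP (sigma (e r)) (sigma (e s))) => // /c_mono; rewrite eq_c ltnn.
exists (perm c_inj); apply/patP => r s; rewrite !permE /=; exact: c_iff.
Qed.

(** Multiplying by such an [L] turns one pattern along [e] into another and changes nothing off the
    image of [e]; all symmetry arguments below use it. *)
Lemma perm_lift l n (e : {ffun 'I_l -> 'I_n}) (tau : 'S_l) : injective e ->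
  exists L : 'S_n, (forall r, L (e r) = e (tau r)) /\
                   (forall x, x \notin codom e -> L x = x).
Proof.
move=> e_inj.
pose h (t : 'S_l) x := if [pick r | e r == x] is Some r then e (t r) else x.
have he t r : h t (e r) = e (t r).
  rewrite /h; case: pickP => [s /eqP/e_inj -> //|/(_ r)]; by rewrite eqxx.
have hout t x : x \notin codom e -> h t x = x.
  rewrite /h; case: pickP => // r /eqP <-; by rewrite codom_f.
have hK t : cancel (h t) (h (t^-1)%g).
  move=> x; case: (boolP (x \in codom e)) => [/codomP[r ->]|xe].
    by rewrite !he permK.
  by rewrite !hout.
exists (perm (can_inj (hK tau))); split=> [r|x xe]; rewrite permE ?he ?hout //.
Qed.

Lemma pat_lift l n (e : {ffun 'I_l -> 'I_n}) (tau rho : 'S_l) (L sigma : 'S_n) :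
  (forall r, L (e r) = e (tau r)) ->
  pat (tau * rho)%g (L * sigma)%g e = pat rho sigma e.
Proof.
move=> Le; apply/patP/patP => H r s; last by rewrite !permM !Le.
by have := H (tau^-1 r)%g (tau^-1 s)%g; rewrite !permM !Le !permKV.
Qed.

Local Notation E n := (@unif_mean R 'S_n).

Lemma card_Sn_gt0 n : (0 < #|{perm 'I_n}|)%N.
Proof. by rewrite card_Sn fact_gt0. Qed.

Lemma mean_pat l n (e : {ffun 'I_l -> 'I_n}) (rho : 'S_l) (F : 'S_n -> R) :
  injective e ->
  (forall (L sigma : 'S_n), (forall x, x \notin codom e -> L x = x) ->
     F (L * sigma)%g = F sigma) ->
  E n (fun sigma => (pat rho sigma e)%:R * F sigma) = E n F / l`!%:R.
Proof.
move=> e_inj F_inv.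
have same rho' : E n (fun sigma => (pat rho' sigma e)%:R * F sigma) =
                 E n (fun sigma => (pat rho sigma e)%:R * F sigma).
  have [L [Le Lout]] := perm_lift (rho * rho'^-1)%g e_inj.
  rewrite -[RHS](mean_bij _ (mulgI L)); apply: eq_mean => sigma.
  by rewrite F_inv // -(pat_lift rho' sigma Le) mulgKV.
apply: (@mulIf _ (l`!%:R)); first by rewrite pnatr_eq0 -lt0n fact_gt0.
rewrite divfK; last by rewrite pnatr_eq0 -lt0n fact_gt0.
have -> : l`! = #|'S_l| by rewrite card_Sn.
rewrite mulr_natr -sumr_const.
rewrite -[LHS](eq_bigr _ (fun r _ => same r)) -mean_sum; apply: eq_mean => sigma.
have [r0 pr0] := pat_ex sigma e_inj.
rewrite (bigD1 r0) //= pr0 mul1r big1 ?addr0 // => r ne_r.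
case: (boolP (pat r sigma e)) => [pr|]; last by rewrite mul0r.
by rewrite (pat_uniq pr pr0) eqxx in ne_r.
Qed.

Lemma mean_pat1 l n (e : {ffun 'I_l -> 'I_n}) (rho : 'S_l) : injective e ->
  E n (fun sigma => (pat rho sigma e)%:R) = l`!%:R^-1.
Proof.
move=> e_inj; have := @mean_pat l n e rho (fun=> 1) e_inj (fun _ _ _ => erefl).
rewrite mean_cst ?card_Sn_gt0 // mul1r => <-.
by apply: eq_mean => s; rewrite mulr1.
Qed.

Lemma pat_ext l n (rho : 'S_l) (s s' : 'S_n) (e : {ffun 'I_l -> 'I_n}) :
  (forall r, s (e r) = s' (e r)) -> pat rho s e = pat rho s' e.
Proof. by move=> ss'; apply/patP/patP => H r t; rewrite H !ss'. Qed.

Lemma mean_pat_disjoint l m n (e : {ffun 'I_l -> 'I_n}) (e' : {ffun 'I_m -> 'I_n})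
    (rho : 'S_l) (rho' : 'S_m) :
  injective e -> injective e' -> (forall r s, e r != e' s) ->
  E n (fun sigma => (pat rho sigma e)%:R * (pat rho' sigma e')%:R)
    = l`!%:R^-1 * m`!%:R^-1.
Proof.
move=> e_inj e'_inj dis; rewrite mean_pat //.
  by rewrite mean_pat1 // mulrC.
move=> L sigma Lout; congr (nat_of_bool _)%:R; apply: pat_ext => r.
by rewrite permM Lout //; apply/codomP => -[s /eqP]; rewrite eq_sym (negbTE (dis _ _)).
Qed.

(** The pattern [t] of [sigma] along [e] is uniform on ['S_l] and decides both events; the
    right-hand side no longer depends on [e]. *)
Lemma mean_pat_comp l m n (e : {ffun 'I_l -> 'I_n}) (f f' : {ffun 'I_m -> 'I_l})
    (rho rho' : 'S_m) : injective e ->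
  E n (fun sigma => (pat rho sigma [ffun r => e (f r)])%:R *
                    (pat rho' sigma [ffun r => e (f' r)])%:R)
    = #|[set t : 'S_l | pat rho t f && pat rho' t f']|%:R / l`!%:R.
Proof.
move=> e_inj.
rewrite -sum1_card natr_sum mulr_suml.
rewrite -[RHS](eq_bigr _ (fun t _ => etrans (mean_pat1 t e_inj) (esym (mul1r _)))).
rewrite -mean_sum; apply: eq_mean => sigma.
have [t0 pt0] := pat_ex sigma e_inj.
have tr (g : {ffun 'I_m -> 'I_l}) (r : 'S_m) : pat r sigma [ffun r => e (g r)] = pat r t0 g.
  by apply/patP/patP => H x y; rewrite H ?ffunE -?(patP _ _ _ pt0) // !ffunE.
rewrite !tr -natrM mulnb.
have zero t : t != t0 -> (pat t sigma e)%:R = 0 :> R.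
  move=> ne; case: (boolP (pat t sigma e)) => // pt.
  by rewrite (pat_uniq pt pt0) eqxx in ne.
case: (boolP (_ && _)) => H /=.
  rewrite (bigD1 t0) ?inE //= pt0 big1 ?addr0 // => t /andP[_ ne]; exact: zero.
rewrite [RHS]big1 // => t tP; apply: zero.
by apply: contraNneq H => <-; rewrite inE in tP.
Qed.

End Patterns.

(** * Increasing position maps with prescribed adjacencies *)

Section Embeddings.
Implicit Types (B : pred nat).

(** Adjacencies are a predicate on [nat], so that the same notion applies to a pattern and to the
    union of two of its occurrences, whatever their lengths. *)
Definition emb B (l n : nat) : {set {ffun 'I_l -> 'I_n}} :=
  [set e : {ffun 'I_l -> 'I_n} |
    [forall r : 'I_l, forall s : 'I_l, (r < s)%N ==> (e r < e s)%N] &&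
    [forall r : 'I_l, forall s : 'I_l,
       B r && (s == r.+1 :> nat) ==> (e s == (e r).+1 :> nat)]].

Lemma embP B l n (e : {ffun 'I_l -> 'I_n}) :
  reflect ((forall r s : 'I_l, (r < s)%N -> (e r < e s)%N) /\
           (forall r s : 'I_l, B r -> s = r.+1 :> nat -> e s = (e r).+1 :> nat))
          (e \in emb B l n).
Proof.
rewrite inE; apply: (iffP andP) => -[H1 H2]; split.
- by move=> r s; have /forallP/(_ s)/implyP := forallP H1 r.
- move=> r s Br sr; have /forallP/(_ s)/implyP := forallP H2 r.
  by rewrite Br sr eqxx => /(_ isT)/eqP.
- by apply/forallP => r; apply/forallP => s; apply/implyP; apply: H1.
- apply/forallP => r; apply/forallP => s; apply/implyP => /andP[Br /eqP sr].
  by apply/eqP; apply: H2.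
Qed.

Lemma emb_inj B l n e : e \in emb B l n -> injective e.
Proof.
case/embP => mono _ r s eq_e; apply/val_inj/eqP.
by case: ltngtP => // /mono; rewrite eq_e ltnn.
Qed.

Lemma emb_lt B l n e : e \in emb B l n ->
  forall r s : 'I_l, (e r < e s)%N = (r < s)%N.
Proof.
move=> He; have /embP[mono _] := He; move=> r s.
apply/idP/idP => [|/mono //]; apply: contraTT; rewrite -!leqNgt leq_eqVlt.
by case/orP => [/eqP/val_inj -> //|/mono/ltnW].
Qed.

Lemma card_incr l n : #|emb pred0 l n| = 'C(n, l).
Proof.
rewrite -card_ltn_sorted_tuples.
pose f (t : l.-tuple 'I_n) : {ffun 'I_l -> 'I_n} := [ffun i => tnth t i].
have f_bij : bijective f.
  exists (fun e : {ffun 'I_l -> 'I_n} => [tuple e i | i < l]) => [t|e].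
    by apply: eq_from_tnth => i; rewrite tnth_mktuple ffunE.
  by apply/ffunP => i; rewrite ffunE tnth_mktuple.
rewrite -(on_card_preimset (onW_bij _ f_bij)); apply: eq_card => t.
have nthE (i : 'I_l) : nth 0%N (map val t) i = tnth t i.
  by rewrite (nth_map (tnth t i)) ?size_tuple // -tnth_nth.
rewrite !inE (sorted_pairwise ltn_trans); apply/andP/(pairwiseP 0%N) => [[H _]|H].
  move=> i j; rewrite !inE size_map size_tuple => Hi Hj lt_ij.
  have := forallP (forallP H (Ordinal Hi)) (Ordinal Hj).
  by rewrite !ffunE -!nthE /= lt_ij.
split; last by apply/forallP => r; apply/forallP.
apply/forallP => r; apply/forallP => s; apply/implyP => lt_rs.
by rewrite !ffunE -!nthE; apply: H; rewrite // inE size_map size_tuple.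
Qed.

Definition nadj B (r : nat) : nat := count B (iota 0 r).
(* Index [r] of the pattern lies in block [blk B r], blocks being numbered from 0. *)
Definition blk B (r : nat) : nat := (r - nadj B r)%N.

Lemma nadj_le B r : (nadj B r <= r)%N.
Proof. by rewrite -[X in (_ <= X)%N](size_iota 0) count_size. Qed.

Lemma nadjS B r : nadj B r.+1 = (nadj B r + B r)%N.
Proof. by rewrite /nadj -addn1 iotaD count_cat /= addn0. Qed.

Lemma nadj_card B m : #|[set x : 'I_m | B (nat_of_ord x)]| = nadj B m.
Proof.
rewrite /nadj -val_enum_ord count_map -size_filter cardE; congr size.
by rewrite /enum_mem -filter_predI; apply: eq_filter => x; rewrite /= !inE andbT.
Qed.

Lemma blkS B r : blk B r.+1 = if B r then blk B r else (blk B r).+1.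
Proof. by rewrite /blk nadjS; have := nadj_le B r; case: (B r); lia. Qed.

Lemma blk_le B r s : (r <= s)%N -> (blk B r <= blk B s)%N.
Proof.
move=> /subnK <-; elim: (s - r)%N => [|d IH]; first by rewrite add0n.
by rewrite addSn (leq_trans IH) // blkS; case: ifP.
Qed.

Lemma nadj_mono B r s : (r <= s)%N -> (nadj B r <= nadj B s)%N.
Proof.
move=> /subnK <-; elim: (s - r)%N => [|d IH]; first by rewrite add0n.
by rewrite addSn (leq_trans IH) // nadjS leq_addr.
Qed.

Lemma blk_surj B l q : (q <= blk B l)%N -> exists2 r, (r <= l)%N & blk B r = q.
Proof.
elim: l => [|l IH]; first by rewrite leqn0 => /eqP ->; exists 0%N.
rewrite blkS; case: (boolP (B l)) => Bl Hq.
  by have [r rl <-] := IH Hq; exists r => //; exact: leqW.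
move: Hq; rewrite leq_eqVlt => /orP[/eqP->|Hq].
  by exists l.+1; rewrite // blkS (negbTE Bl).
by have [r rl <-] := IH Hq; exists r => //; exact: leqW.
Qed.

(** A step inside a block raises the position by exactly one, a step to a new block by at least one.
    Both claims are phrased additively to avoid truncated subtraction. *)
Lemma emb_gap B l n (e : {ffun 'I_l -> 'I_n}) (r s : 'I_l) :
  e \in emb B l n -> (r <= s)%N ->
  (e r + nadj B s + (blk B s - blk B r) <= e s + nadj B r)%N /\
  (blk B s = blk B r -> (e s + nadj B r = e r + nadj B s)%N).
Proof.
case/embP => mono adj; case: s => s hs /=; elim: s hs => [|s IH] hs.
  rewrite leqn0 => /eqP r0; have -> : r = Ordinal hs by apply/val_inj.
  by rewrite /= subnn addn0.
rewrite leq_eqVlt => /orP[/eqP rs|].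
  have -> : r = Ordinal hs by apply/val_inj.
  by rewrite /= subnn addn0.
rewrite ltnS => rs; have [IH1 IH2] := IH (ltnW hs) rs.
have lt_e := mono (Ordinal (ltnW hs)) (Ordinal hs) (ltnSn s).
have ble := blk_le B rs; rewrite blkS nadjS; case: ifP => Bs.
  have eS := adj (Ordinal (ltnW hs)) (Ordinal hs) Bs erefl.
  by split => [|/IH2]; lia.
by split; lia.
Qed.

Lemma emb_ge B l n (e : {ffun 'I_l -> 'I_n}) (r : 'I_l) : e \in emb B l n -> (nadj B r <= e r)%N.
Proof.
move=> He; have l_gt0 : (0 < l)%N by exact: leq_ltn_trans (ltn_ord r).
have [+ _] := emb_gap He (leq0n r : (Ordinal l_gt0 <= r)%N).
by rewrite /= /nadj /=; lia.
Qed.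

Lemma emb_section B l n (e e' : {ffun 'I_l -> 'I_n}) (r s : 'I_l) :
  e \in emb B l n -> e' \in emb B l n -> blk B r = blk B s -> e r = e' r -> e s = e' s.
Proof.
move=> He He' eq_b eq_e; apply/val_inj => /=.
have := emb_ge r He; have := emb_ge s He; have := emb_ge r He'; have := emb_ge s He'.
have [rs|/ltnW sr] := leqP r s.
  have [_ /(_ (esym eq_b))] := emb_gap He rs.
  have [_ /(_ (esym eq_b))] := emb_gap He' rs.
  by rewrite eq_e; lia.
have [_ /(_ eq_b)] := emb_gap He sr.
have [_ /(_ eq_b)] := emb_gap He' sr.
by rewrite eq_e; lia.
Qed.

(** Subtracting from each position the number of adjacencies before it collapses every block to a
    point and leaves a strictly increasing map on the blocks; [up] is the inverse operation. *)
Lemma card_emb B l m :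
  #|emb B l.+1 (nadj B l + m).+1| = 'C(m.+1, (blk B l).+1).
Proof.
set t := nadj B l; set d := blk B l.
rewrite -card_incr.
pose up (g : {ffun 'I_d.+1 -> 'I_m.+1}) : {ffun 'I_l.+1 -> 'I_(t + m).+1} :=
  [ffun r : 'I_l.+1 => inord (g (inord (blk B r)) + nadj B r)].
have rl (r : 'I_l.+1) : (r <= l)%N by rewrite -ltnS.
have vb (r : 'I_l.+1) : @inord d (blk B r) = blk B r :> nat.
  by rewrite inordK // ltnS blk_le.
have upE g (r : 'I_l.+1) : up g r = (g (inord (blk B r)) + nadj B r)%N :> nat.
  rewrite ffunE inordK //; have := ltn_ord (g (inord (blk B r))).
  by have := nadj_mono B (rl r); rewrite -/t; lia.
have exs (q : 'I_d.+1) : exists r : 'I_l.+1, blk B r == q.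
  have [r hr <-] := @blk_surj B l q (ltn_ord q).
  by exists (Ordinal (hr : (r < l.+1)%N)).
(* Any representative of the block will do, since [e r - nadj B r] is constant on a block. *)
pose sec (q : 'I_d.+1) : 'I_l.+1 := xchoose (exs q).
have secK q : inord (blk B (sec q)) = q.
  by apply/val_inj; rewrite /= vb; apply/eqP/(xchooseP (exs q)).
have secB q : blk B (sec q) = q by have /(congr1 val) := secK q; rewrite /= vb.
clearbody sec.
have up_inj : injective up.
  move=> g g' eq_up; apply/ffunP => q; apply/val_inj/eqP => /=.
  have := upE g (sec q); rewrite eq_up upE secK => eq_g.
  by rewrite -(eqn_add2r (nadj B (sec q))) eq_g.
rewrite -(card_imset _ up_inj).
suff imE (e : {ffun 'I_l.+1 -> 'I_(t + m).+1}) :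
  (e \in emb B l.+1 (t + m).+1) = (e \in up @: emb pred0 d.+1 m.+1).
  by apply: eq_card => e; apply: imE.
apply/idP/imsetP => [He|[g Hg ->]].
  pose g : {ffun 'I_d.+1 -> 'I_m.+1} :=
    [ffun q : 'I_d.+1 => inord (e (sec q) - nadj B (sec q))].
  have gE (q : 'I_d.+1) : g q = (e (sec q) - nadj B (sec q))%N :> nat.
    rewrite ffunE inordK // ltnS.
    have [+ _] := emb_gap He (rl (sec q) : (sec q <= ord_max)%N) => /=.
    have := ltn_ord (e ord_max); have := emb_ge (sec q) He; rewrite -/t; lia.
  exists g.
    apply/embP; split=> // q q' lt_q; rewrite !gE.
    have [le_s|/ltnW/(blk_le B)] := leqP (sec q) (sec q'); last by rewrite !secB; lia.
    have [+ _] := emb_gap He le_s; rewrite !secB.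
    by have := emb_ge (sec q) He; have := emb_ge (sec q') He; lia.
  apply/ffunP => r; apply/val_inj; rewrite /= upE gE.
  set s := sec _.
  have bs : blk B s = blk B r by rewrite secB vb.
  have := emb_ge r He; have := emb_ge s He.
  have [rs|/ltnW sr] := leqP r s.
    by have [_ /(_ bs)] := emb_gap He rs; lia.
  by have [_ /(_ (esym bs))] := emb_gap He sr; lia.
have /embP[mono _] := Hg.
apply/embP; split=> [r s rs|r s Br sr]; rewrite !upE; last first.
  by rewrite sr blkS nadjS Br; lia.
have := blk_le B (ltnW rs); rewrite leq_eqVlt => /orP[/eqP eq_b|lt_b].
  by rewrite eq_b; move: eq_b rs; rewrite /blk; have := nadj_le B r;
     have := nadj_le B s; lia.
have := @mono (inord (blk B r)) (inord (blk B s)); rewrite !vb => /(_ lt_b).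
by have := nadj_mono B (ltnW rs); lia.
Qed.

Lemma card_embE B l n : (nadj B l < n)%N ->
  #|emb B l.+1 n| = 'C(n - nadj B l, (blk B l).+1).
Proof.
move=> lt_n; have -> : n = (nadj B l + (n - (nadj B l).+1)).+1 by lia.
by rewrite card_emb; congr 'C(_, _); lia.
Qed.

End Embeddings.

(** * Interleavings of two position sets *)

Section Merging.
Variables (K : nat) (B : pred nat).
Hypothesis B_lt : forall r, B r -> (r < K)%N.

Lemma incr_enum n l (U : {set 'I_n}) : #|U| = l ->
  exists2 e : {ffun 'I_l -> 'I_n}, e \in emb pred0 l n & codom e =i U.
Proof.
move=> <-; exists [ffun x => enum_val x].
  have srt : sorted ltn (map val (enum U)).
    rewrite {1}/enum_mem -enumT.
    apply: (subseq_sorted ltn_trans (map_subseq _ (filter_subseq _ _))).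
    by rewrite val_enum_ord iota_ltn_sorted.
  apply/embP; split=> // r s lt_rs; rewrite !ffunE.
  have x0 := enum_val r; rewrite !(enum_val_nth x0).
  rewrite -!(nth_map x0 0%N val) -?cardE //.
  move: srt; rewrite (sorted_pairwise ltn_trans) => /(pairwiseP 0%N) srt.
  by apply: srt => //; rewrite inE size_map -cardE.
move=> u; apply/codomP/idP => [[x ->]|Uu]; first by rewrite ffunE enum_valP.
by exists (enum_rank_in Uu u); rewrite ffunE enum_rankK_in.
Qed.

(** The index [x] is the number of image points below [e x], and so is read off the image. *)
Lemma incr_codom n l (e e' : {ffun 'I_l -> 'I_n}) :
  e \in emb pred0 l n -> e' \in emb pred0 l n -> codom e =i codom e' -> e = e'.
Proof.
have rk (g : {ffun 'I_l -> 'I_n}) (x : 'I_l) : g \in emb pred0 l n ->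
    #|[set u in codom g | (u < g x)%N]| = x :> nat.
  move=> Hg; have -> : [set u in codom g | (u < g x)%N] = g @: [set y : 'I_l | (y < x)%N].
    apply/setP => u; rewrite inE; apply/andP/imsetP => [[/codomP[y ->]]|[y]].
      by rewrite (emb_lt Hg) => lt_yx; exists y; rewrite ?inE.
    by rewrite inE -(emb_lt Hg) => lt_yx ->; rewrite codom_f.
  rewrite card_imset; last exact: emb_inj Hg.
  rewrite -[RHS](card_lt_perm (1%g : 'S_l) (ltnW (ltn_ord x))).
  by apply: eq_card => y; rewrite !inE perm1.
move=> He He' eqc; apply/ffunP => x.
have /codomP[z ez] : e' x \in codom e by rewrite eqc codom_f.
rewrite ez; congr (e _); apply/val_inj; rewrite /= -(rk e' x He') -(rk e z He).
by apply: eq_card => u; rewrite !inE ez eqc.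
Qed.

Lemma emb_pred0 C l n (e : {ffun 'I_l -> 'I_n}) : e \in emb C l n -> e \in emb pred0 l n.
Proof. by case/embP => mono _; apply/embP. Qed.

Definition comp_ffun m l n (e : {ffun 'I_l -> 'I_n}) (f : {ffun 'I_m -> 'I_l}) :
  {ffun 'I_m -> 'I_n} := [ffun r => e (f r)].

Lemma comp_ffunE m l n (e : {ffun 'I_l -> 'I_n}) (f : {ffun 'I_m -> 'I_l}) r :
  comp_ffun e f r = e (f r).
Proof. exact: ffunE. Qed.

(** These are the interleavings: the ways two position sets can sit inside their union, once the
    union has been renumbered as ['I_l]. *)
Definition merges l : {set {ffun 'I_K.+1 -> 'I_l} * {ffun 'I_K.+1 -> 'I_l}} :=
  [set p | [&& p.1 \in emb B K.+1 l, p.2 \in emb B K.+1 l &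
            [forall x, (x \in codom p.1) || (x \in codom p.2)]]].

Lemma mergesP l p :
  reflect [/\ p.1 \in emb B K.+1 l, p.2 \in emb B K.+1 l &
            forall x, (x \in codom p.1) || (x \in codom p.2)] (p \in merges l).
Proof.
rewrite [p \in _]inE; apply: (iffP and3P) => -[? ? H]; split=> //; exact/forallP.
Qed.

Definition merge_adj l (p : {ffun 'I_K.+1 -> 'I_l} * {ffun 'I_K.+1 -> 'I_l})
  : pred nat :=
  fun x => [exists r : 'I_K.+1, B r && ((p.1 r == x :> nat) || (p.2 r == x :> nat))].

Definition footprint n (p : {ffun 'I_K.+1 -> 'I_n} * {ffun 'I_K.+1 -> 'I_n})
  : {set 'I_n} := [set x | (x \in codom p.1) || (x \in codom p.2)].

Lemma emb_comp (C : pred nat) l n (e : {ffun 'I_l -> 'I_n}) (f : {ffun 'I_K.+1 -> 'I_l}) :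
  (forall r : 'I_K.+1, B r -> C (f r)) ->
  f \in emb B K.+1 l -> e \in emb C l n -> comp_ffun e f \in emb B K.+1 n.
Proof.
move=> BC /embP[fm fa] /embP[em ea]; apply/embP; split=> [r s rs|r s Br sr]; rewrite !ffunE.
  by apply: em; apply: fm.
by apply: ea; [exact: BC|exact: fa].
Qed.

(** Adjacency survives the renumbering: an index strictly between [f r] and [f s] would be sent by
    [e] strictly between two consecutive positions. *)
Lemma emb_factor l n (e : {ffun 'I_l -> 'I_n}) (i : {ffun 'I_K.+1 -> 'I_n}) :
  e \in emb pred0 l n -> i \in emb B K.+1 n -> {subset codom i <= codom e} ->
  exists2 f : {ffun 'I_K.+1 -> 'I_l}, f \in emb B K.+1 l & i = comp_ffun e f.
Proof.
move=> He /embP[im ia] sub.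
have ex r : exists x, e x == i r.
  by have /codomP[x ->] := sub _ (codom_f i r); exists x.
pose f : {ffun 'I_K.+1 -> 'I_l} := [ffun r => xchoose (ex r)].
have ef r : e (f r) = i r by rewrite ffunE; exact/eqP/(xchooseP (ex r)).
exists f; last by apply/ffunP => r; rewrite ffunE ef.
have fm (r s : 'I_K.+1) : (r < s)%N -> (f r < f s)%N.
  by move=> rs; rewrite -(emb_lt He) !ef im.
apply/embP; split=> // r s Br sr.
have lt_f : (f r < f s)%N by apply: fm; rewrite sr.
apply/eqP; rewrite eqn_leq lt_f andbT leqNgt; apply/negP => gap.
pose y := Ordinal (ltn_trans gap (ltn_ord (f s))).
have := emb_lt He (f r) y; have := emb_lt He y (f s); rewrite /= !ef gap ltnSn.
by rewrite (ia r s Br sr); lia.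
Qed.

(** The map [e] is the increasing enumeration of the union of the two images, and its injectivity
    then returns the two factors. *)
Lemma merge_inj l n :
  {in [set x : ({ffun 'I_K.+1 -> 'I_l} * {ffun 'I_K.+1 -> 'I_l}) * {ffun 'I_l -> 'I_n}
        | (x.1 \in merges l) && (x.2 \in emb (merge_adj x.1) l n)] &,
   injective (fun x => (comp_ffun x.2 x.1.1, comp_ffun x.2 x.1.2))}.
Proof.
move=> [[f f'] e] [[g g'] d]; rewrite [in X in X -> _]inE [in X in _ -> X -> _]inE /=.
move=> /andP[/mergesP[_ _ /= sf] /emb_pred0 He].
move=> /andP[/mergesP[_ _ /= sg] /emb_pred0 Hd] [E1 E2].
have eE r : e (f r) = d (g r) by have /ffunP/(_ r) := E1; rewrite !ffunE.
have eE' r : e (f' r) = d (g' r) by have /ffunP/(_ r) := E2; rewrite !ffunE.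
have ed : e = d.
  apply: incr_codom => // u; apply/codomP/codomP => -[x ->].
    have /orP[/codomP[r ->]|/codomP[r ->]] := sf x; first by exists (g r).
    by exists (g' r).
  have /orP[/codomP[r ->]|/codomP[r ->]] := sg x; first by exists (f r).
  by exists (f' r).
subst d; have ei := emb_inj He.
by congr (_, _, _); apply/ffunP => r; apply: ei.
Qed.

Lemma merge_image l n (p : {ffun 'I_K.+1 -> 'I_n} * {ffun 'I_K.+1 -> 'I_n}) :
  (p \in [set (comp_ffun x.2 x.1.1, comp_ffun x.2 x.1.2) | x in
     [set x : ({ffun 'I_K.+1 -> 'I_l} * {ffun 'I_K.+1 -> 'I_l}) * {ffun 'I_l -> 'I_n}
        | (x.1 \in merges l) && (x.2 \in emb (merge_adj x.1) l n)]]) =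
  [&& p.1 \in emb B K.+1 n, p.2 \in emb B K.+1 n & #|footprint p| == l].
Proof.
apply/imsetP/and3P => [[[[f f'] e]]|[]].
  rewrite inE /= => /andP[/mergesP[/= Hf Hf' sf] He] -> /=; split.
  - apply: emb_comp Hf He => r Br; apply/existsP; exists r.
    by rewrite Br eqxx.
  - apply: emb_comp Hf' He => r Br; apply/existsP; exists r.
    by rewrite Br eqxx orbT.
  have -> : footprint (comp_ffun e f, comp_ffun e f') = e @: [set: 'I_l].
    apply/setP => u; rewrite inE /=; apply/orP/imsetP => [[]/codomP[r ->]|[x _ ->]].
    - by exists (f r); rewrite ?inE ?comp_ffunE.
    - by exists (f' r); rewrite ?inE ?comp_ffunE.
    have /orP[/codomP[r ->]|/codomP[r ->]] := sf x; [left|right].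
      by apply/codomP; exists r; rewrite comp_ffunE.
    by apply/codomP; exists r; rewrite comp_ffunE.
  by rewrite card_imset ?cardsT ?card_ord //; exact: emb_inj He.
case: p => i i' /= Hi Hi' /eqP cU.
have [e He ce] := incr_enum cU.
have subi : {subset codom i <= codom e} by move=> u ui; rewrite ce inE /= ui.
have subi' : {subset codom i' <= codom e} by move=> u ui; rewrite ce inE /= ui orbT.
have [f Hf fE] := emb_factor He Hi subi.
have [f' Hf' fE'] := emb_factor He Hi' subi'.
exists ((f, f'), e); last by rewrite /= -fE -fE'.
have ei := emb_inj He.
rewrite inE /=; apply/andP; split.
  apply/mergesP; split=> //= x; have := codom_f e x; rewrite ce inE /= fE fE'.
  case/orP => /codomP[r]; rewrite comp_ffunE => /ei ->; first by rewrite codom_f.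
  by rewrite codom_f orbT.
have /embP[em _] := He.
have adj (g : {ffun 'I_K.+1 -> 'I_l}) (x y : 'I_l) (r : 'I_K.+1) :
    g \in emb B K.+1 l -> comp_ffun e g \in emb B K.+1 n -> B r -> g r = x ->
    y = x.+1 :> nat -> e y = (e x).+1 :> nat.
  move=> /embP[_ ga] /embP[_ ca] Br gx yx.
  have rK : (r.+1 < K.+1)%N by exact: B_lt.
  have := ca r (Ordinal rK) Br erefl; rewrite !comp_ffunE gx => <-.
  congr (nat_of_ord (e _)); apply/val_inj; rewrite /= yx -gx.
  by rewrite (ga r (Ordinal rK) Br erefl).
apply/embP; split=> // x y /existsP[r /andP[Br /orP[] /eqP/val_inj gx]] yx.
  by apply: (adj f x y r); rewrite // -fE.
by apply: (adj f' x y r); rewrite // -fE'.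
Qed.

Lemma footprint_disjoint n (i i' : {ffun 'I_K.+1 -> 'I_n}) :
  i \in emb B K.+1 n -> i' \in emb B K.+1 n ->
  (forall r s, i r != i' s) \/ (#|footprint (i, i')| < (K.+1).*2)%N.
Proof.
move=> Hi Hi'.
have cE (g : {ffun 'I_K.+1 -> 'I_n}) : g \in emb B K.+1 n -> #|g @: [set: 'I_K.+1]| = K.+1.
  by move=> Hg; rewrite card_imset ?cardsT ?card_ord //; exact: emb_inj Hg.
have -> : footprint (i, i') = (i @: setT) :|: (i' @: setT).
  apply/setP => u; rewrite !inE /=.
  by congr (_ || _); apply/codomP/imsetP => [[x ->]|[x _ ->]]; exists x.
rewrite cardsU !cE // -addnn.
have [/eqP|] := boolP (i @: setT :&: i' @: setT == set0).
  move=> dis; left => r s; apply/eqP => eq_rs.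
  have : i r \in i @: setT :&: i' @: setT by rewrite inE {2}eq_rs !imset_f.
  by rewrite dis inE.
by rewrite -card_gt0 => c0; right; move: c0; set c := #|_|; lia.
Qed.

Lemma footprint_gt0 n (i i' : {ffun 'I_K.+1 -> 'I_n}) : (0 < #|footprint (i, i')|)%N.
Proof. by apply/card_gt0P; exists (i ord0); rewrite inE /= codom_f. Qed.

(** Pairs are sorted by the size of their union. Overlapping pairs have a union of size between 1
    and [2 * K + 1], which is [l.+1] for an [l] in the range of the sum. *)
Lemma sum_merge (R : realType) n
    (F : {ffun 'I_K.+1 -> 'I_n} -> {ffun 'I_K.+1 -> 'I_n} -> R) :
  (forall i i', i \in emb B K.+1 n -> i' \in emb B K.+1 n ->
     (forall r s, i r != i' s) -> F i i' = 0) ->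
  \sum_(i in emb B K.+1 n) \sum_(i' in emb B K.+1 n) F i i' =
  \sum_(l < (K.*2).+1) \sum_(p in merges l.+1)
     \sum_(e in emb (merge_adj p) l.+1 n) F (comp_ffun e p.1) (comp_ffun e p.2).
Proof.
move=> F0; rewrite pair_big /=.
rewrite (bigID (fun p => #|footprint p| < (K.+1).*2)%N) /= [X in _ + X]big1 ?addr0; last first.
  move=> [i i'] /= /andP[/andP[Hi Hi'] big].
  by have [dis|/idPn] := footprint_disjoint Hi Hi'; [exact: F0|rewrite big].
rewrite (partition_big (fun p => inord (#|footprint p|.-1) : 'I_(K.*2).+1) xpredT) //=.
apply: eq_bigr => l _; rewrite pair_big_dep /=.
under [RHS]eq_bigl => x do rewrite -(in_set (fun x => (x.1 \in merges l.+1) &&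
   (x.2 \in emb (merge_adj x.1) l.+1 n))).
rewrite -(big_imset (fun p => F p.1 p.2) (@merge_inj l.+1 n)) /=.
apply: eq_bigl => -[i i']; rewrite merge_image /= -!andbA.
case: (boolP (i \in _)) => //= Hi; case: (boolP (i' \in _)) => //= Hi'.
have := footprint_gt0 i i'; have := ltn_ord l.
case: (ltnP #|footprint (i, i')| (K.+1).*2) => /= Hc lt_l c0.
  rewrite -val_eqE /= inordK; last by move: Hc; rewrite doubleS; lia.
  by apply/eqP/eqP; lia.
by apply/esym/eqP => Hl; move: Hc; rewrite Hl doubleS; lia.
Qed.

(** By inclusion-exclusion, the union has twice the blocks of one pattern, minus the shared
    positions, plus the shared adjacencies. The bound on [l] forces an overlap, and the largest
    shared position starts no shared adjacency, for its successor would be shared too. Hence at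
    least one block is lost. *)
Lemma blk_merge l (p : {ffun 'I_K.+1 -> 'I_l.+1} * {ffun 'I_K.+1 -> 'I_l.+1}) :
  p \in merges l.+1 -> (l < (K.*2).+1)%N ->
  ((blk (merge_adj p) l).+1 <= 2 * (blk B K).+1 - 1)%N.
Proof.
case: p => f f'; move=> /mergesP[/= Hf Hf' sf] lK.
set C := merge_adj (f, f').
pose P := [set x : 'I_K.+1 | B x].
have cP : #|P| = nadj B K.
  rewrite nadj_card nadjS; case: (boolP (B K)) => [/B_lt|]; last by rewrite addn0.
  by rewrite ltnn.
have fi := emb_inj Hf; have fi' := emb_inj Hf'.
have CE : [set x : 'I_l.+1 | C x] = f @: P :|: f' @: P.
  apply/setP => x; rewrite !inE; apply/existsP/orP => [[r /andP[Br]]|].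
    case/orP => /eqP/val_inj <-; [left|right]; by rewrite imset_f // inE.
  case=> /imsetP[r]; rewrite inE => Br ->; exists r; by rewrite Br eqxx ?orbT.
have TE : [set: 'I_l.+1] = f @: setT :|: f' @: setT.
  apply/esym/setP => x; rewrite !inE.
  by have /orP[/codomP[r ->]|/codomP[r ->]] := sf x; rewrite imset_f ?orbT.
(* A point starting an adjacency has a successor in ['I_l.+1], so the last point starts none. *)
have Cl : nadj C l.+1 = nadj C l.
  rewrite nadjS; case: (boolP (C l)) => [|]; last by rewrite addn0.
  case/existsP => r /andP[/[dup] Br /B_lt rK].
  have /embP[_ fa] := Hf; have /embP[_ fa'] := Hf'.
  have := fa r (Ordinal (rK : (r.+1 < K.+1)%N)) Br erefl.
  have := fa' r (Ordinal (rK : (r.+1 < K.+1)%N)) Br erefl.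
  have := ltn_ord (f (Ordinal (rK : (r.+1 < K.+1)%N))).
  have := ltn_ord (f' (Ordinal (rK : (r.+1 < K.+1)%N))).
  by move=> h1 h2 h3 h4 /= /orP[] /eqP h; move: h1 h2 h3 h4; rewrite h; lia.
have c1 : (nadj C l + #|f @: P :&: f' @: P| = nadj B K + nadj B K)%N.
  rewrite -Cl -nadj_card CE cardsU !card_imset // cP subnK //.
  by rewrite (leq_trans (subset_leq_card (subsetIl _ _))) // card_imset // cP leq_addr.
have c2 : (l.+1 + #|f @: setT :&: f' @: setT| = K.+1 + K.+1)%N.
  rewrite -[X in (X + _)%N]card_ord -cardsT TE cardsU !card_imset // cardsT card_ord subnK //.
  by rewrite (leq_trans (subset_leq_card (subsetIl _ _))) // card_imset // cardsT card_ord leq_addr.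
have c3 : (#|f @: P :&: f' @: P| < #|f @: setT :&: f' @: setT|)%N.
  have /card_gt0P[x0 Hx0] : (0 < #|f @: setT :&: f' @: setT|)%N by lia.
  apply/proper_card/properP; split.
    by apply: setISS; apply: imsetS; apply: subsetT.
  case: (arg_maxnP (fun x : 'I_l.+1 => nat_of_ord x) Hx0) => x Hx max_x.
  exists x => //; apply/negP; rewrite inE.
  case/andP => /imsetP[r]; rewrite inE => Br xr /imsetP[r']; rewrite inE => Br' xr'.
  have /embP[_ fa] := Hf; have /embP[_ fa'] := Hf'.
  have e1 := fa r (Ordinal (B_lt Br : (r.+1 < K.+1)%N)) Br erefl.
  have e2 := fa' r' (Ordinal (B_lt Br' : (r'.+1 < K.+1)%N)) Br' erefl.
  have e3 : f (Ordinal (B_lt Br : (r.+1 < K.+1)%N)) =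
            f' (Ordinal (B_lt Br' : (r'.+1 < K.+1)%N)).
    by apply/val_inj; rewrite /= e1 e2 -xr -xr'.
  have yI : f (Ordinal (B_lt Br : (r.+1 < K.+1)%N)) \in f @: setT :&: f' @: setT.
    by rewrite inE {2}e3 !imset_f // inE.
  by have := max_x _ yI; rewrite e1 -xr; lia.
by rewrite /blk; have := nadj_le B K; have := nadj_le C l; lia.
Qed.

End Merging.

(** * Convergence of the normalised variance *)

Section VarianceExpansion.
Variables (R : realType) (K : nat) (B : pred nat) (pi : 'S_K.+1).
Hypothesis B_lt : forall r, B r -> (r < K)%N.

Definition Nocc n (sigma : 'S_n) : R :=
  \sum_(i in emb B K.+1 n) (pat pi sigma i)%:R.

(** The covariance of the indicators of two occurrences that interleave as [p]. *)
Definition merge_cov l (p : {ffun 'I_K.+1 -> 'I_l} * {ffun 'I_K.+1 -> 'I_l}) : R :=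
  #|[set t : 'S_l | pat pi t p.1 && pat pi t p.2]|%:R / l`!%:R
    - (K.+1)`!%:R^-1 * (K.+1)`!%:R^-1.

Lemma var_Nocc n : unif_var (@Nocc n) =
  \sum_(l < (K.*2).+1) \sum_(p in merges K B l.+1)
     merge_cov p * #|emb (merge_adj B p) l.+1 n|%:R.
Proof.
pose F (i i' : {ffun 'I_K.+1 -> 'I_n}) : R :=
  unif_mean (fun s : 'S_n => (pat pi s i)%:R * (pat pi s i')%:R)
    - (K.+1)`!%:R^-1 * (K.+1)`!%:R^-1.
have -> : unif_var (@Nocc n) =
    \sum_(i in emb B K.+1 n) \sum_(i' in emb B K.+1 n) F i i'.
  have mN : unif_mean (@Nocc n) = \sum_(i in emb B K.+1 n) (K.+1)`!%:R^-1.
    by rewrite mean_sum; apply: eq_bigr => i /emb_inj; apply: mean_pat1.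
  rewrite varE ?card_Sn_gt0 // mN big_distrlr /=.
  under [X in X - _]eq_mean => s do rewrite /Nocc big_distrlr /=.
  rewrite mean_sum -sumrB; apply: eq_bigr => i _.
  by rewrite mean_sum -sumrB.
rewrite (sum_merge B_lt) => [|i i' Hi Hi' dis]; last first.
  by rewrite /F mean_pat_disjoint ?subrr //; [exact: emb_inj Hi|exact: emb_inj Hi'].
apply: eq_bigr => l _; apply: eq_bigr => p _.
rewrite mulr_natr -sumr_const.
apply: eq_bigr => e He; rewrite /F /merge_cov -(mean_pat_comp R _ _ _ _ (emb_inj He)).
by [].
Qed.

End VarianceExpansion.

(** * Limits of normalised counts and of the normalised variance *)

Section Limits.
Local Open Scope classical_set_scope.
Variable R : realType.
Implicit Types u v : nat -> R.

Definition converges u := exists L : R, u @ \oo --> L.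

Lemma converges_cst a : converges (fun=> a).
Proof. by exists a; apply: cvg_cst. Qed.

Lemma convergesM u v : converges u -> converges v -> converges (fun n => u n * v n).
Proof. by move=> [a ua] [b vb]; exists (a * b); apply: cvgM. Qed.

Lemma converges_sum (I : Type) (r : seq I) (P : pred I) (F : I -> nat -> R) :
  (forall i, P i -> converges (F i)) -> converges (fun n => \sum_(i <- r | P i) F i n).
Proof.
move=> HF; elim: r => [|i r [a IH]].
  by exists 0; under eq_fun do rewrite big_nil; apply: cvg_cst.
under eq_fun do rewrite big_cons.
case: (boolP (P i)) => Pi; last by exists a.
by have [b Hb] := HF i Pi; exists (b + a); apply: cvgD.
Qed.

Lemma converges_eventually u v N :
  (forall n, (N <= n)%N -> u n = v n) -> converges u -> converges v.
Proof.
move=> uv [a ua]; exists a; apply: cvg_trans ua; apply: near_eq_cvg.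
by near=> n; apply: uv; near: n; exact: nbhs_infty_ge.
Unshelve. all: by end_near.
Qed.

Lemma cvg_invn : (fun n : nat => n%:R^-1 : R) @ \oo --> (0 : R).
Proof. by rewrite -cvg_shiftS; exact: cvg_harmonic. Qed.

Lemma converges_ratio c : converges (fun n => (n - c)%:R / n%:R : R).
Proof.
apply: (@converges_eventually (fun n => 1 - c%:R * n%:R^-1) _ c.+1) => [n cn|].
  rewrite natrB 1?ltnW // mulrBl divff // pnatr_eq0; lia.
exists (1 - c%:R * 0); apply: cvgB; first exact: cvg_cst.
by apply: cvgM; [exact: cvg_cst|exact: cvg_invn].
Qed.

(** Induction through [(d + 1) * 'C(m, d + 1) = (m - d) * 'C(m, d)]: each step adds a factor
    [(n - (t + d)) / n] and a constant. *)
Lemma converges_bin t d : converges (fun n => 'C(n - t, d)%:R / n%:R ^+ d : R).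
Proof.
elim: d => [|d IH].
  by under eq_fun do rewrite bin0 expr0 divr1; exact: converges_cst.
have := convergesM (convergesM IH (converges_ratio (t + d))) (converges_cst d.+1%:R^-1).
congr converges; apply/funext => n.
have dn0 : (d.+1%:R : R) != 0 by rewrite pnatr_eq0.
apply: (mulfI dn0); rewrite [RHS]mulrA -natrM mul_bin_left natrM -subnDA exprSr invfM.
by rewrite mulrCA mulfV // mulr1; ring.
Qed.

Lemma converges_card_emb B l D : ((blk B l).+1 <= D)%N ->
  converges (fun n => #|emb B l.+1 n|%:R / n%:R ^+ D : R).
Proof.
move=> leD; set t := nadj B l; set d := (blk B l).+1.
apply: (@converges_eventually
  (fun n => 'C(n - t, d)%:R / n%:R ^+ d * n%:R^-1 ^+ (D - d)) _ t.+1) => [n tn|].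
  rewrite card_embE // -/t -/d.
  by rewrite -mulrA exprVn -invfM -exprD subnKC.
apply: convergesM; first exact: converges_bin.
elim: (D - d)%N => [|m IH]; first by under eq_fun do rewrite expr0; exact: converges_cst.
under eq_fun do rewrite exprS; apply: convergesM => //.
by exists 0; exact: cvg_invn.
Qed.

Lemma converges_var K (B : pred nat) (pi : 'S_K.+1) : (forall r, B r -> (r < K)%N) ->
  converges (fun n => unif_var (@Nocc R K B pi n) / n%:R ^+ (2 * (blk B K).+1 - 1)).
Proof.
move=> B_lt.
under eq_fun => n do rewrite var_Nocc // mulr_suml.
apply: converges_sum => l _.
under eq_fun => n do rewrite mulr_suml.
apply: converges_sum => p Hp.
under eq_fun => n do rewrite -mulrA.
apply: convergesM; first exact: converges_cst.
by apply: converges_card_emb; apply: blk_merge Hp _.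
Qed.

End Limits.

(** * Lower bound for at least two blocks *)

Section SmallValues.
Variables (R : realType) (n N : nat).
Hypotheses (n_gt0 : (0 < n)%N) (N_le : (N <= n)%N).

Definition small (m : 'I_n) (s : 'S_n) : R := (s m < N)%:R.

Lemma sum_small (s : 'S_n) : \sum_m small m s = N%:R.
Proof.
rewrite /small -natr_sum -big_mkcond /= sum1_card -[in RHS](card_lt_perm s N_le).
by congr (_%:R); apply: eq_card => m; rewrite inE.
Qed.

Lemma mean_small m : unif_mean (small m) = N%:R / n%:R.
Proof.
have same m' : unif_mean (small m') = unif_mean (small m).
  rewrite -(mean_bij (small m) (mulgI (tperm m m'))); apply: eq_mean => s.
  by rewrite /small permM tpermL.
have n0 : n%:R != 0 :> R by rewrite pnatr_eq0 -lt0n.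
apply: (mulIf n0); rewrite divfK // mulr_natr.
have <- : \sum_(m' : 'I_n) unif_mean (small m) = unif_mean (small m) *+ n.
  by rewrite sumr_const card_ord.
rewrite -[LHS](eq_bigr _ (fun m' _ => same m')) -mean_sum.
rewrite (eq_mean (Y := fun=> N%:R)) ?mean_cst ?card_Sn_gt0 // => s.
exact: sum_small.
Qed.

(** Negative correlation: by symmetry all pairs of distinct positions have the same mean [T], and
    multiplying the constant sum [N] of the indicators by one of them gives
    [N / n + (n - 1) * T = N * (N / n)]. *)
Lemma mean_small2 m m' : m != m' ->
  unif_mean (fun s => small m s * small m' s) <= (N%:R / n%:R) ^+ 2.
Proof.
move=> ne; set T := unif_mean _.
have same m'' : m'' != m -> unif_mean (fun s => small m s * small m'' s) = T.
  move=> ne'; rewrite /T -(mean_bij _ (mulgI (tperm m' m''))); apply: eq_mean => s.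
  by rewrite /small !permM tpermR tpermD // eq_sym.
have total : N%:R / n%:R + n.-1%:R * T = N%:R * (N%:R / n%:R).
  rewrite -[in RHS](mean_small m) -[RHS]meanZ.
  under [RHS]eq_mean => s do rewrite -(sum_small s) mulr_suml.
  rewrite mean_sum (bigD1 m) //=; congr (_ + _).
    rewrite -(mean_small m); apply: eq_mean => s.
    by rewrite /small -natrM mulnb andbb.
  under eq_bigr => m'' ne' do rewrite (eq_mean (fun s => mulrC _ _)) (same m'' ne').
  rewrite sumr_const mulr_natl; congr (_ *+ _).
  by have := cardC1 m; rewrite card_ord => <-; apply: eq_card => x; rewrite !inE.
have n2 : (1 < n)%N.
  have := ltn_ord m; have := ltn_ord m'; move: ne; rewrite -val_eqE /=; lia.
have n0 : 0 < n%:R :> R by rewrite ltr0n.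
have n1 : 0 < n.-1%:R :> R by rewrite ltr0n; lia.
rewrite -(ler_pM2l n1).
have -> : n.-1%:R * T = N%:R * (N%:R / n%:R) - N%:R / n%:R by rewrite -total addrC addKr.
have -> : n.-1%:R = n%:R - 1 :> R by rewrite -subn1 natrB ?(ltnW n2).
have Nn : N%:R <= n%:R :> R by rewrite ler_nat.
set x := N%:R / n%:R; have -> : N%:R = x * n%:R :> R by rewrite divfK ?lt0r_neq0.
have x0 : 0 <= x by rewrite divr_ge0 ?ler0n.
have x1 : x <= 1 by rewrite ler_pdivrMr ?mul1r.
nra.
Qed.

End SmallValues.

(** * The corner test variable and its correlation with occurrences *)

Section Corner.
Variables (R : realType) (K : nat) (B : pred nat) (pi : 'S_K.+1).
Variables (n N Q : nat) (W : {set 'I_n}) (r0 r1 : 'I_K.+1).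
Hypotheses (N_gt0 : (0 < N)%N) (Q_gt0 : (0 < Q)%N) (nE : n = (Q * N)%N).
Hypotheses (cardW : #|W| = N) (pi_r0 : pi r0 = ord0).

Let n_gt0 : (0 < n)%N. Proof. by rewrite nE muln_gt0 Q_gt0. Qed.
Let N_le : (N <= n)%N. Proof. by rewrite nE leq_pmull. Qed.
Let qE : N%:R / n%:R = Q%:R^-1 :> R.
Proof. by rewrite nE natrM invfM mulrCA mulfV ?mulr1 // pnatr_eq0 -lt0n. Qed.

Local Notation s_ m := (@small R n N m).

(** The deficit of small values on the positions [W]: each of these [N] positions is small with
    probability [N / n = 1 / Q]. *)
Definition corner (s : 'S_n) : R := N%:R / Q%:R - \sum_(m in W) s_ m s.

Lemma mean_corner : unif_mean corner = 0.
Proof.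
rewrite meanB mean_cst ?card_Sn_gt0 // mean_sum.
under eq_bigr do rewrite mean_small // qE.
by rewrite sumr_cst cardW subrr.
Qed.

(** Writing [c = N / Q], the diagonal terms of the second moment of the sum contribute at most [c],
    and the others at most [c ^+ 2] by negative correlation; centring removes [c ^+ 2]. *)
Lemma var_corner : unif_mean (fun s => corner s * corner s) <= N%:R / Q%:R.
Proof.
have sq (x y : R) : (x - y) * (x - y) = y * y - 2 * x * y + x ^+ 2 by ring.
have mS : unif_mean (fun s => \sum_(m in W) s_ m s) = N%:R / Q%:R.
  by have /esym/eqP := mean_corner; rewrite meanB mean_cst ?card_Sn_gt0 // eq_sym subr_eq0 => /eqP.
set c := N%:R / Q%:R.
rewrite (eq_mean (Y := fun s => \sum_(m in W) \sum_(m' in W) s_ m s * s_ m' s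
   - 2 * c * (\sum_(m in W) s_ m s) + c ^+ 2)); last first.
  move=> s; have <- : (\sum_(m in W) s_ m s) * (\sum_(m in W) s_ m s) =
    \sum_(m in W) \sum_(m' in W) s_ m s * s_ m' s by exact: big_distrlr.
  exact: sq.
rewrite meanD meanB meanZ mS mean_cst ?card_Sn_gt0 // mean_sum -/c.
suff : \sum_(m in W) unif_mean (fun s => \sum_(m' in W) s_ m s * s_ m' s) <= c + c ^+ 2.
  by move=> H; lra.
have -> : c + c ^+ 2 = \sum_(m in W) (Q%:R^-1 + N%:R * Q%:R^-1 ^+ 2).
  by rewrite sumr_cst cardW /c; ring.
apply: ler_sum => m mW; rewrite mean_sum (bigD1 m) //=; apply: lerD.
  rewrite -qE -(mean_small R n_gt0 N_le m); apply: mean_le => s.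
  by rewrite /small -natrM mulnb andbb.
rewrite -qE.
apply: le_trans (_ : \sum_(i in W | i != m) (N%:R / n%:R) ^+ 2 <= _).
  apply: ler_sum => m' /andP[_ ne]; apply: mean_small2; rewrite // eq_sym //.
rewrite sumr_cst ler_wpM2r ?sqr_ge0 // ler_nat -cardW.
by apply: subset_leq_card; apply/subsetP => x /andP[].
Qed.

(** Positions of [W] off the image of [i] are independent of the pattern and cancel. For [r != r0],
    a small value at [i r] in an occurrence forces one at [i r0], where the minimum sits, so that
    both are small, with probability at most [q ^+ 2]. At [r0] itself the trivial bound [q] is used.
    As [Q] is at least the factorial, [k1 * q - q ^+ 2] is nonnegative and all terms but the one at
    [r1] may be dropped. *)
Lemma mean_pat_corner (i : {ffun 'I_K.+1 -> 'I_n}) : i \in emb B K.+1 n ->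
  ((K.+1)`! <= Q)%N ->
  (i r1 \in W)%:R * ((K.+1)`!%:R^-1 / Q%:R - Q%:R^-1 ^+ 2) - (i r0 \in W)%:R / Q%:R
  <= unif_mean (fun s => (pat pi s i)%:R * corner s).
Proof.
move=> Hi leQ; have i_inj := emb_inj Hi.
set k1 : R := (K.+1)`!%:R^-1; set q : R := Q%:R^-1.
have k0 : 0 < k1 by rewrite invr_gt0 ltr0n fact_gt0.
have q0 : 0 < q by rewrite invr_gt0 ltr0n.
have qk : q <= k1 by rewrite lef_pV2 ?posrE ?ltr0n ?fact_gt0 // ler_nat.
have -> : unif_mean (fun s => (pat pi s i)%:R * corner s) =
    \sum_(m in W) (k1 * q - unif_mean (fun s => (pat pi s i)%:R * s_ m s)).
  under eq_mean => s do rewrite mulrBr mulr_sumr mulrC.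
  rewrite meanB meanZ mean_pat1 // mean_sum sumrB sumr_cst cardW.
  by rewrite /k1 /q; congr (_ - _); ring.
have off m : m \notin codom i -> unif_mean (fun s => (pat pi s i)%:R * s_ m s) = k1 * q.
  move=> mi; rewrite mean_pat //.
    by rewrite mean_small // qE mulrC.
  by move=> L s Lout; rewrite /small permM Lout.
rewrite (bigID (fun m => m \in codom i)) /= [X in _ <= _ + X]big1 ?addr0; last first.
  by move=> m /andP[_ /off ->]; rewrite subrr.
have -> : \sum_(m in W | m \in codom i) (k1 * q - unif_mean (fun s => (pat pi s i)%:R * s_ m s))
   = \sum_(r | i r \in W) (k1 * q - unif_mean (fun s => (pat pi s i)%:R * s_ (i r) s)).
  pose G m := k1 * q - unif_mean (fun s => (pat pi s i)%:R * s_ m s).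
  rewrite -[LHS]/(\sum_(m in W | m \in codom i) G m).
  rewrite (eq_bigl (fun m => m \in i @: [set r | i r \in W])) => [|m]; last first.
    apply/andP/imsetP => [[mW /codomP[r mr]]|[r]].
      by exists r; rewrite // inE -mr.
    by rewrite inE => irW ->; rewrite irW codom_f.
  rewrite big_imset /=; last by move=> x y _ _ /i_inj.
  by apply: eq_bigl => r; rewrite inE.
have term r : k1 * q - q ^+ 2 - (r == r0)%:R * q <=
    k1 * q - unif_mean (fun s => (pat pi s i)%:R * s_ (i r) s).
  have [->|ne] := eqVneq r r0.
    suff : unif_mean (fun s => (pat pi s i)%:R * s_ (i r0) s) <= q.
      by have := sqr_ge0 q; rewrite /= mul1r; lra.
    rewrite /q -qE -(mean_small R n_gt0 N_le (i r0)); apply: mean_le => s.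
    by rewrite ler_piMl ?ler0n // lern1 leq_b1.
  suff : unif_mean (fun s => (pat pi s i)%:R * s_ (i r) s) <= q ^+ 2.
    by rewrite /= mul0r subr0; lra.
  have ne_i : i r != i r0 by apply: contra_neq ne => /i_inj.
  rewrite /q -qE; apply: le_trans (mean_small2 R n_gt0 N_le ne_i).
  apply: mean_le => s; rewrite /small -!natrM ler_nat !mulnb.
  case: (boolP (pat pi s i)) => //= /patP ps.
  have : (s (i r0) < s (i r))%N.
    by rewrite -ps pi_r0 lt0n; apply: contra_neq ne => /eqP p0;
       apply: (@perm_inj _ pi); apply/val_inj; rewrite pi_r0; exact/eqP.
  by case: (ltnP (s (i r)) N) => //= lt1 lt2; rewrite (ltn_trans lt2).
apply: le_trans (_ : \sum_(r | i r \in W) (k1 * q - q ^+ 2 - (r == r0)%:R * q) <= _); last first.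
  by apply: ler_sum => r _; apply: term.
rewrite sumrB -mulr_suml; apply: lerB; last first.
  apply: ler_wpM2r; first exact: ltW.
  have [i0|i0] := boolP (i r0 \in W).
    rewrite (bigD1 r0) //= eqxx big1 => [|r /andP[_ ne]]; first by rewrite addr0.
    by rewrite (negbTE ne).
  rewrite big1 // => r irW; case: eqVneq => // r_r0.
  by rewrite r_r0 (negbTE i0) in irW.
have pos : 0 <= k1 * q - q ^+ 2 by nra.
case: (boolP (i r1 \in W)) => i1; last by rewrite mul0r; apply: sumr_ge0.
by rewrite mul1r (bigD1 r1) //= lerDl; apply: sumr_ge0.
Qed.

Lemma mean_Nocc_corner : ((K.+1)`! <= Q)%N ->
  #|[set i in emb B K.+1 n | i r1 \in W]|%:R * ((K.+1)`!%:R^-1 / Q%:R - Q%:R^-1 ^+ 2)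
   - #|[set i in emb B K.+1 n | i r0 \in W]|%:R / Q%:R
  <= unif_mean (fun s => Nocc R B pi s * corner s).
Proof.
move=> leQ.
have cE (r : 'I_K.+1) : #|[set i in emb B K.+1 n | i r \in W]|%:R
    = \sum_(i in emb B K.+1 n) (i r \in W)%:R :> R.
  rewrite -sum1_card natr_sum.
  rewrite (eq_bigl (fun i => (i \in emb B K.+1 n) && (i r \in W))) => [|i]; last by rewrite inE.
  by rewrite big_mkcondr /=; apply: eq_bigr => i _; case: ifP.
rewrite !cE; under eq_mean do rewrite /Nocc mulr_suml.
rewrite mean_sum !mulr_suml -sumrB; apply: ler_sum => i Hi.
exact: mean_pat_corner.
Qed.

End Corner.

(** * Counting position maps relative to the extreme positions *)

Section CornerCounts.
Variables (K : nat) (B : pred nat).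
Local Notation d := (blk B K).

(** A map is determined by one index per block. With [r0] and [r1] representing their own blocks,
    two of the [d.+1] choices lie in [W] and the other [d.-1] are at most [n] each. *)
Lemma card_two_anchors n (W : {set 'I_n}) (r0 r1 : 'I_K.+1) : blk B r0 != blk B r1 ->
  (#|[set i in emb B K.+1 n | (i r0 \in W) && (i r1 \in W)]| <= #|W| * #|W| * n ^ d.-1)%N.
Proof.
move=> ne_b.
pose b (r : 'I_K.+1) : 'I_d.+1 := inord (blk B r).
have bE r : b r = blk B r :> nat by rewrite inordK // ltnS blk_le // -ltnS.
have exs (q : 'I_d.+1) : exists r, b r == q.
  have [r hr eq_q] := @blk_surj B K q (ltn_ord q).
  by exists (Ordinal (hr : (r < K.+1)%N)); rewrite -val_eqE /= bE eq_q.
pose sec (q : 'I_d.+1) : 'I_K.+1 :=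
  if q == b r0 then r0 else if q == b r1 then r1 else xchoose (exs q).
have secK q : b (sec q) = q.
  rewrite /sec; case: eqP => [->//|_]; case: eqP => [->//|_].
  exact/eqP/(xchooseP (exs q)).
have ne01 : b r1 != b r0 by rewrite -val_eqE /= !bE eq_sym.
pose F (q : 'I_d.+1) : pred 'I_n :=
  [pred x | ((q == b r0) || (q == b r1)) ==> (x \in W)].
pose h (i : {ffun 'I_K.+1 -> 'I_n}) : {ffun 'I_d.+1 -> 'I_n} := [ffun q => i (sec q)].
have h_inj : {in emb B K.+1 n &, injective h}.
  move=> i i' Hi Hi' /ffunP eq_h; apply/ffunP => r.
  apply: (emb_section (r := sec (b r)) Hi Hi'); first by rewrite -bE secK bE.
  by have := eq_h (b r); rewrite !ffunE.
set D := [set _ in _ | _].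
have subD : {subset D <= emb B K.+1 n} by move=> i; rewrite inE => /andP[].
rewrite -(card_in_imset (f := h) (D := D)); last first.
  by move=> i i' /subD Hi /subD Hi'; apply: h_inj.
apply: leq_trans (_ : #|[pred f in family F]| <= _)%N.
  apply/subset_leq_card/subsetP => _ /imsetP[i iD ->]; rewrite inE.
  apply/familyP => q; rewrite ffunE inE /sec.
  move: iD; rewrite inE => /and3P[_ i0 i1].
  by case: (q == b r0) => //=; case: (q == b r1).
have -> : (#|[pred f in family F]| = \prod_q \sum_(x in F q) 1)%N.
  rewrite -sum1_card; transitivity (\sum_(f in family F) 1)%N.
    by apply: eq_bigl => f; rewrite inE.
  by rewrite bigA_distr_big_dep; apply: eq_bigr => f _; rewrite big1.
rewrite (bigD1 (b r0)) //= (bigD1 (b r1)) //= mulnA.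
have FW q : (q == b r0) || (q == b r1) -> (\sum_(x in F q) 1 = #|W|)%N.
  by move=> Hq; rewrite sum1_card; apply: eq_card => x; rewrite !inE Hq.
rewrite !FW ?eqxx ?orbT // leq_mul2l; apply/orP; right.
apply: leq_trans (_ : \prod_(q | (q != b r0) && (q != b r1)) n <= _)%N.
  by apply: leq_prod => q _; rewrite sum1_card -[X in (_ <= X)%N]card_ord max_card.
rewrite prod_nat_const; apply: eq_leq; congr (_ ^ _)%N.
have := cardsC [set b r0; b r1]; rewrite cards2 card_ord eq_sym ne01 /= => cC.
have -> : #|[pred q | (q != b r0) && (q != b r1)]| = #|~: [set b r0; b r1]|.
  by apply: eq_card => q; rewrite !inE negb_or.
by apply/eqP; rewrite -(eqn_add2l 2) cC; apply/eqP; have := ltn_ord (b r1); move: ne01; rewrite -val_eqE /= !bE; lia.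
Qed.

Lemma bin_addl_ge x N m : (N * 'C(x, m) + 'C(x, m.+1) <= 'C(x + N, m.+1))%N.
Proof.
elim: N => [|N IH]; first by rewrite addn0.
rewrite addnS binS mulSn -addnA addnC leq_add //.
by apply: leq_bin2l; exact: leq_addr.
Qed.

Lemma bin_fact_ge x m : ((x - m) ^ m <= 'C(x, m) * m`!)%N.
Proof.
rewrite bin_ffact ffact_prod -[X in (_ ^ X)%N](card_ord m) -prod_nat_const.
by apply: leq_prod => i _; rewrite leq_sub2l // ltnW.
Qed.

(** Translation by [N] sends these maps injectively to maps into [n - N] positions. *)
Lemma card_first_outside n N : (nadj B K < n - N)%N ->
  (#|[set i in emb B K.+1 n | (N <= i ord0)%N]| <= 'C(n - N - nadj B K, d.+1))%N.
Proof.
move=> lt_n; rewrite -card_embE //.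
have [m nN] : exists m, n = (m + N).+1 by exists (n - N).-1; lia.
subst n; have -> : ((m + N).+1 - N = m.+1)%N by lia.
pose h (i : {ffun 'I_K.+1 -> 'I_(m + N).+1}) : {ffun 'I_K.+1 -> 'I_m.+1} :=
  [ffun r => inord (i r - N)].
have ge (i : {ffun 'I_K.+1 -> 'I_(m + N).+1}) (r : 'I_K.+1) : i \in [set i in emb B K.+1 (m + N).+1 | (N <= i ord0)%N] -> (N <= i r)%N.
  rewrite inE => /andP[Hi /leq_trans]; apply.
  by rewrite leqNgt (emb_lt Hi).
have hE (i : {ffun 'I_K.+1 -> 'I_(m + N).+1}) (r : 'I_K.+1) : i \in [set i in emb B K.+1 (m + N).+1 | (N <= i ord0)%N] ->
    h i r = (i r - N)%N :> nat.
  by move=> /(@ge i r) Hr; rewrite ffunE inordK //; have := ltn_ord (i r); lia.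
rewrite -(card_in_imset (f := h)); last first.
  move=> i i' Hi Hi' /ffunP eq_h; apply/ffunP => r; apply/val_inj => /=.
  have := congr1 val (eq_h r); rewrite /= !hE //.
  by have := @ge i r Hi; have := @ge i' r Hi'; lia.
apply/subset_leq_card/subsetP => _ /imsetP[i iD ->].
have /andP[/embP[im ia] _] : (i \in emb B K.+1 (m + N).+1) && (N <= i ord0)%N.
  by move: iD; rewrite inE.
apply/embP; split=> [r s rs|r s Br sr]; rewrite !hE //.
  by have := im r s rs; have := @ge i r iD; lia.
by rewrite (ia r s Br sr) subSn // ge.
Qed.

Lemma card_last_outside n N : (nadj B K < n - N)%N ->
  (#|[set i in emb B K.+1 n | (i ord_max < n - N)%N]| <= 'C(n - N - nadj B K, d.+1))%N.
Proof.
move=> lt_n; rewrite -card_embE //.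
have [m nN] : exists m, n = (m + N).+1 by exists (n - N).-1; lia.
subst n; have -> : ((m + N).+1 - N = m.+1)%N by lia.
pose h (i : {ffun 'I_K.+1 -> 'I_(m + N).+1}) : {ffun 'I_K.+1 -> 'I_m.+1} :=
  [ffun r => inord (i r)].
have hE (i : {ffun 'I_K.+1 -> 'I_(m + N).+1}) (r : 'I_K.+1) : i \in [set i in emb B K.+1 (m + N).+1 | (i ord_max < m.+1)%N] ->
    h i r = i r :> nat.
  rewrite inE => /andP[Hi lt_i]; rewrite ffunE inordK //; apply: leq_ltn_trans lt_i.
  by rewrite leqNgt (emb_lt Hi) -leqNgt -ltnS.
rewrite -(card_in_imset (f := h)); last first.
  move=> i i' Hi Hi' /ffunP eq_h; apply/ffunP => r; apply/val_inj => /=.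
  by have := congr1 val (eq_h r); rewrite /= !hE.
apply/subset_leq_card/subsetP => _ /imsetP[i iD ->].
have /andP[/embP[im ia] _] : (i \in emb B K.+1 (m + N).+1) && (i ord_max < m.+1)%N.
  by move: iD; rewrite inE.
apply/embP; split=> [r s rs|r s Br sr]; rewrite !hE //; first exact: im.
exact: ia.
Qed.

End CornerCounts.

(** * The variance bound along multiples of [Q] when there are several blocks *)

Section SeveralBlocks.
Variables (R : realType) (K : nat) (B : pred nat) (pi : 'S_K.+1).
Local Notation d := (blk B K).
Local Notation a := (nadj B K).
Let k1 := (K.+1)`!.
Let H := (d`! * 2 ^ d)%N.
Let Q := (4 * (k1 * H))%N.

(** Covers both ends at once: [W] is the set of [N] extreme positions and [r1] the extreme index on
    that side. Sending [r0] into [W] drags [r1] along, which pins two blocks and is rarer, by a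
    factor of order [1 / Q], than sending [r1] alone into [W]. *)
Lemma var_ge_window N (W : {set 'I_(Q * N)}) (r0 r1 : 'I_K.+1) :
  (a + d < N)%N -> (0 < d)%N -> pi r0 = ord0 -> blk B r0 != blk B r1 -> #|W| = N ->
  (forall i : {ffun 'I_K.+1 -> 'I_(Q * N)},
     i \in emb B K.+1 (Q * N) -> i r0 \in W -> i r1 \in W) ->
  (#|[set i in emb B K.+1 (Q * N) | i r1 \notin W]| <= 'C(Q * N - N - a, d.+1))%N ->
  Q%:R^-1 ^+ 4 * (Q * N)%:R ^+ (2 * d.+1 - 1) <= unif_var (@Nocc R K B pi (Q * N)).
Proof.
set n := (Q * N)%N => N_gt d_gt0 pi_r0 ne_b cardW W_r1 out.
have k1_gt0 : (0 < k1)%N by rewrite fact_gt0.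
have H_gt0 : (0 < H)%N by rewrite muln_gt0 fact_gt0 expn_gt0.
have Q_gt0 : (0 < Q)%N by rewrite /Q (muln_gt0 4) (muln_gt0 k1) k1_gt0 H_gt0.
have Q_ge4 : (4 <= Q)%N by move: Q_gt0; rewrite /Q; lia.
have n_ge : (4 * N <= n)%N by rewrite leq_mul2r Q_ge4 orbT.
have N_gt0 : (0 < N)%N by lia.
set N1 := #|[set i in emb B K.+1 n | i r1 \in W]|.
set N0 := #|[set i in emb B K.+1 n | i r0 \in W]|.
have N0_le : (Q * N0 <= N * n ^ d)%N.
  have : (N0 <= N * N * n ^ d.-1)%N.
    rewrite -cardW; apply: leq_trans (card_two_anchors (n := n) W ne_b).
    apply/subset_leq_card/subsetP => i; rewrite !inE => /andP[Hi i0].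
    by rewrite Hi i0 /= W_r1 // inE.
  rewrite -(leq_pmul2l Q_gt0) => /leq_trans; apply.
  by rewrite -[in (n ^ d)%N](prednK d_gt0) expnS /n; apply: eq_leq; ring.
have N1_ge : (N * n ^ d <= H * N1)%N.
  have tot : ('C(n - a, d.+1) = N1 + #|[set i in emb B K.+1 n | i r1 \notin W]|)%N.
    rewrite -card_embE; last by lia.
    rewrite -(cardsID [set i : {ffun 'I_K.+1 -> 'I_n} | i r1 \in W]).
    by congr (_ + _)%N; apply: eq_card => i; rewrite !inE // andbC.
  have := bin_addl_ge (n - N - a) N d.
  have -> : (n - N - a + N = n - a)%N by lia.
  rewrite tot => le_bin.
  have {le_bin} le1 : (N * 'C(n - N - a, d) <= N1)%N.
    by rewrite -(leq_add2r #|[set i in emb B K.+1 n | i r1 \notin W]|)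
      (leq_trans _ le_bin) // leq_add2l.
  apply: leq_trans (_ : H * (N * 'C(n - N - a, d)) <= _)%N; last by rewrite leq_mul2l le1 orbT.
  have -> : (H * (N * 'C(n - N - a, d)) = N * (2 ^ d * ('C(n - N - a, d) * d`!)))%N.
    by rewrite /H; ring.
  rewrite leq_mul2l; apply/orP; right.
  apply: leq_trans (_ : 2 ^ d * (n - N - a - d) ^ d <= _)%N; last first.
    by rewrite leq_mul2l bin_fact_ge orbT.
  (* Since [a + d < N] and [4 * N <= n], the base [2 * (n - N - a - d)] is at least [n]. *)
  by rewrite -expnMn leq_exp2r //; lia.
set q : R := Q%:R^-1; set x : R := n%:R ^+ d.
have q0 : 0 < q by rewrite invr_gt0 ltr0n.
have x0 : 0 <= x by rewrite exprn_ge0 ?ler0n.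
have qQ : q * Q%:R = 1 by rewrite mulVf // pnatr_eq0 -lt0n.
have nE : n%:R = Q%:R * N%:R :> R by rewrite natrM.
have k1Q : (k1 <= Q)%N by rewrite /Q; nia.
have cov := mean_Nocc_corner R B r1 N_gt0 Q_gt0 erefl cardW pi_r0 k1Q.
have covle : q ^+ 2 * N%:R * x <= unif_mean (fun s => Nocc R B pi s * corner R N Q W s).
  apply: le_trans cov; rewrite -/N1 -/N0 -/q -/k1.
  have r0le : N0%:R <= q * N%:R * x.
    rewrite -(ler_pM2l (_ : 0 < Q%:R)) ?ltr0n // -natrM.
    rewrite (_ : Q%:R * (q * N%:R * x) = N%:R * x); last by rewrite !mulrA [Q%:R * q]mulrC qQ mul1r.
    by rewrite /x -natrX -natrM ler_nat.
  have r1ge : N%:R * x <= H%:R * N1%:R.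
    by rewrite /x -natrX -!natrM ler_nat.
  have H0 : 0 < H%:R :> R by rewrite ltr0n.
  have k0 : 0 < k1%:R :> R by rewrite ltr0n.
  (* With this value the gain from [N1] is at least [2 * q ^+ 2 * N * x], while the loss from [N0]
     is at most [q ^+ 2 * N * x]. *)
  have kq : k1%:R^-1 = 4 * H%:R * q :> R.
    by rewrite /q /Q natrM [(k1 * H)%:R]natrM; field; apply/andP; split; apply: lt0r_neq0.
  have H1 : 1 <= H%:R :> R by rewrite ler1n.
  have N1_0 : 0 <= N1%:R :> R by rewrite ler0n.
  rewrite kq.
  have -> : N1%:R * (4 * H%:R * q * q - q ^+ 2) = q ^+ 2 * (4 * (H%:R * N1%:R) - N1%:R) by ring.
  have t1 : N1%:R <= H%:R * N1%:R :> R by rewrite ler_peMl.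
  have t2 : N0%:R * q <= q ^+ 2 * (N%:R * x).
    by have := ler_wpM2l (ltW q0) r0le; lra.
  have t3 : 2 * (N%:R * x) <= 4 * (H%:R * N1%:R) - N1%:R by nra.
  have q2 : 0 < q ^+ 2 by rewrite exprn_gt0.
  rewrite -mulrA; nra.
(* [lam = q * x] maximises [2 * lam * (q ^+ 2 * N * x) - lam ^+ 2 * (q * N)]. *)
have := var_ge (@Nocc R K B pi n) (q * x) (mean_corner R N_gt0 Q_gt0 erefl cardW).
move=> /(le_trans _); apply.
have var := var_corner R N_gt0 Q_gt0 erefl cardW; rewrite -/q in var.
have -> : q ^+ 4 * n%:R ^+ (2 * d.+1 - 1) = q ^+ 3 * N%:R * x ^+ 2.
  have -> : (2 * d.+1 - 1 = 1 + d * 2)%N by lia.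
  rewrite exprD expr1 exprM -/x nE.
  by transitivity ((q * Q%:R) * (q ^+ 3 * N%:R * x ^+ 2)); [ring|rewrite qQ mul1r].
have qx0 : 0 <= q * x by rewrite mulr_ge0 // ltW.
have l1 : 2 * (q * x) * (q ^+ 2 * N%:R * x) <=
    2 * (q * x) * unif_mean (fun s => Nocc R B pi s * corner R N Q W s).
  by rewrite ler_wpM2l // mulr_ge0.
have l2 : (q * x) ^+ 2 * unif_mean (fun s => corner R N Q W s * corner R N Q W s) <=
    (q * x) ^+ 2 * (N%:R * q) by rewrite ler_wpM2l // sqr_ge0.
apply: le_trans (lerB l1 l2); lra.
Qed.

Lemma var_ge_multi : (0 < d)%N ->
  exists (Q N0 : nat) (c : R), [/\ (0 < Q)%N, 0 < c & forall N, (N0 <= N)%N ->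
    c * (Q * N)%:R ^+ (2 * d.+1 - 1) <= unif_var (@Nocc R K B pi (Q * N))].
Proof.
move=> d_gt0.
have Q_gt0 : (0 < Q)%N by rewrite /Q /k1 /H !muln_gt0 !fact_gt0 expn_gt0.
exists Q, (a + d).+1, (Q%:R^-1 ^+ 4); split=> // [|N N_gt].
  by rewrite exprn_gt0 // invr_gt0 ltr0n.
have Q_ge4 : (4 <= Q)%N by move: Q_gt0; rewrite /Q; lia.
have n_ge : (4 * N <= Q * N)%N by rewrite leq_mul2r Q_ge4 orbT.
have card_lt m : (m <= Q * N)%N -> #|[set x : 'I_(Q * N) | (x < m)%N]| = m.
  move=> Hm; rewrite -[RHS](card_lt_perm (1%g : 'S_(Q * N)) Hm).
  by apply: eq_card => x; rewrite !inE perm1.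
pose r0 := (pi^-1)%g ord0.
have pi_r0 : pi r0 = ord0 by rewrite permKV.
(* If the minimum lies in the first block, work at the right end with the last index; otherwise at
   the left end with the first. *)
have [b0|b0] := eqVneq (blk B r0) 0%N.
  apply: (@var_ge_window N [set x : 'I_(Q * N) | (Q * N - N <= x)%N] r0 ord_max) => //.
  - by rewrite b0 /= eq_sym -lt0n.
  - have := card_lt (Q * N - N)%N (leq_subr _ _).
    have := cardsC [set x : 'I_(Q * N) | (x < Q * N - N)%N].
    rewrite card_ord => h1 h2; rewrite (_ : [set x | _] = ~: [set x : 'I_(Q * N) | (x < Q * N - N)%N]).
      by apply/eqP; rewrite -(eqn_add2l (Q * N - N)) -{1}h2 h1 eq_sym subnK //; lia.
    by apply/setP => x; rewrite !inE -leqNgt.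
  - move=> i Hi; rewrite !inE => /leq_trans; apply.
    by rewrite leqNgt (emb_lt Hi) -leqNgt -ltnS.
  apply: leq_trans (card_last_outside (n := Q * N) (N := N) _); last by lia.
  by apply/subset_leq_card/subsetP => i; rewrite !in_set -ltnNge.
apply: (@var_ge_window N [set x : 'I_(Q * N) | (x < N)%N] r0 ord0) => //.
- by apply: card_lt; lia.
- move=> i Hi; rewrite !inE; apply: leq_ltn_trans.
  by rewrite leqNgt (emb_lt Hi).
apply: leq_trans (card_first_outside (n := Q * N) (N := N) _); last by lia.
by apply/subset_leq_card/subsetP => i; rewrite !in_set -leqNgt.
Qed.

End SeveralBlocks.

(** * Lower bound for a single block *)

Section SingleBlock.
Variables (R : realType) (K : nat) (B : pred nat) (pi : 'S_K.+1).
Hypotheses (K_gt0 : (0 < K)%N) (B_full : blk B K = 0%N).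
(** Three times the pattern length, so that an occurrence meeting the middle third of a window stays
    inside the window. *)
Let w := (3 * K).+3.
Let up : bool := pi != 1%g.

(* A monotone permutation, increasing unless [pi] itself is. *)
Definition mono l : 'S_l := if up then 1%g else perm (@rev_ord_inj l).

Lemma mono_lt l (x y : 'I_l) : (mono l x < mono l y)%N = if up then (x < y)%N else (y < x)%N.
Proof.
rewrite /mono; case: up; rewrite ?perm1 ?permE //=.
by have := ltn_ord x; have := ltn_ord y; lia.
Qed.

Lemma mono_neq : mono K.+1 != pi.
Proof.
apply/eqP => E; case: (boolP up) => [up1|up0].
  by move: (up1); rewrite /up -E /mono up1 eqxx.
have := mono_lt ord0 (ord_max : 'I_K.+1).
by rewrite (negbTE up0) E; move/negPn/eqP: up0 => ->; rewrite !perm1 /= K_gt0.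
Qed.

Definition mid : {ffun 'I_K.+1 -> 'I_w} := [ffun r : 'I_K.+1 => inord (K.+1 + r)].

Lemma midE r : mid r = (K.+1 + r)%N :> nat.
Proof. by rewrite ffunE inordK //; have := ltn_ord r; lia. Qed.

Lemma mid_inj : injective mid.
Proof. by move=> r s /(congr1 val); rewrite /= !midE => /addnI/val_inj. Qed.

Lemma bump_ex : exists T tau : 'S_w,
  [/\ (T * tau)%g = mono w, pat pi tau mid,
      (forall r, exists s, T (mid r) = mid s) & forall x, x \notin codom mid -> T x = x].
Proof.
(* [v] sends an index to the one where [pi] takes the value of [mono]; undoing it on the middle
   third turns the monotone order there into [pi]. *)
pose v : 'S_K.+1 := (mono K.+1 * pi^-1)%g.
have [T [Tm Tout]] := perm_lift v mid_inj.
exists T, (T^-1 * mono w)%g; split=> //; first by rewrite mulgA mulgV mul1g.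
  apply/patP => r s.
  have Tm' x : (T^-1)%g (mid x) = mid ((v^-1)%g x) by rewrite -[x in LHS](permKV v) -Tm permK.
  rewrite !permM !Tm' mono_lt !midE !ltn_add2l.
  have vE x : mono K.+1 ((v^-1)%g x) = pi x by rewrite /v invMg invgK permM permKV.
  by rewrite -!vE mono_lt.
by move=> r; exists (v r).
Qed.

Lemma full_emb n (i : {ffun 'I_K.+1 -> 'I_n}) r : i \in emb B K.+1 n ->
  i r = (i ord0 + r)%N :> nat.
Proof.
move=> Hi; have [_ gap] := emb_gap Hi (leq0n r : (ord0 <= r)%N).
have rK : (r <= K)%N by rewrite -ltnS.
have b0 : blk B r = 0%N by apply/eqP; rewrite -leqn0 -B_full blk_le.
have nr : nadj B r = r by move: b0 (nadj_le B r); rewrite /blk; lia.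
by move: gap; rewrite b0 nr /= addn0 => /(_ erefl).
Qed.

(** * Disjoint windows and the effect of rearranging one of them *)

Section Windows.
Variable N : nat.
Local Notation n := (w * N)%N.

Lemma win_lt (q : 'I_N) (x : 'I_w) : (q * w + x < n)%N.
Proof.
apply: (@leq_trans (q.+1 * w)); first by rewrite mulSn addnC ltn_add2r.
by rewrite mulnC leq_mul2l ltn_ord orbT.
Qed.

Definition win (q : 'I_N) : {ffun 'I_w -> 'I_n} := [ffun x => Ordinal (win_lt q x)].

Lemma winE q x : win q x = (q * w + x)%N :> nat.
Proof. by rewrite ffunE. Qed.

Lemma win_inj q : injective (win q).
Proof. by move=> x y /(congr1 val); rewrite /= !winE => /addnI/val_inj. Qed.

Lemma win_disjoint q q' : q != q' -> forall x y, win q x != win q' y.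
Proof.
move=> ne x y; apply: contra_neq ne => /(congr1 val); rewrite /= !winE => E.
apply/val_inj => /=; have := congr1 (fun z => z %/ w)%N E.
by rewrite !divnMDl // !divn_small ?addn0.
Qed.

(** Making the window monotone destroys the occurrence [i0] in its middle third and creates none: an
    occurrence in [L * s] is already one in [s]. *)
Lemma Nocc_bump (T tau : 'S_w) q (L s : 'S_n) :
  (T * tau)%g = mono w -> pat pi tau mid ->
  (forall r, exists r', T (mid r) = mid r') -> (forall x, x \notin codom mid -> T x = x) ->
  (forall x, L (win q x) = win q (T x)) -> (forall y, y \notin codom (win q) -> L y = y) ->
  pat tau s (win q) -> Nocc R B pi (L * s)%g + 1 <= Nocc R B pi s.
Proof.
move=> TE ptau Tmid Tout Lwin Lout ps.
have pLs : pat (mono w) (L * s)%g (win q) by rewrite -TE pat_lift.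
pose i0 := comp_ffun (win q) mid.
have i0E r : i0 r = (q * w + K.+1 + r)%N :> nat by rewrite comp_ffunE winE midE addnA.
have Hi0 : i0 \in emb B K.+1 n.
  apply/embP; split=> [r t rt|r t _ tr]; rewrite !i0E; first by rewrite ltn_add2l.
  by rewrite tr addnS.
(* The occurrence positions are consecutive, so inside the window they carry a monotone pattern,
   which is not [pi]. *)
have no_mono (i : {ffun 'I_K.+1 -> 'I_n}) y : i \in emb B K.+1 n -> i ord0 = (q * w + y)%N :> nat ->
    (y + K < w)%N -> pat pi (L * s)%g i = false.
  move=> Hi iy yw; apply/negP => pi_i; have := mono_neq; apply/negP; rewrite negbK; apply/eqP.
  apply: pat_uniq pi_i; apply/patP => r t.
  have iE z : i z = win q (inord (y + z)).
    apply/val_inj; rewrite /= winE full_emb // iy inordK ?addnA //.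
    by have := ltn_ord z; move: yw; rewrite /w; lia.
  have vE (z : 'I_K.+1) : @inord (3 * K).+2 (y + z) = (y + z)%N :> nat.
    by rewrite inordK //; have := ltn_ord z; move: yw; rewrite /w; lia.
  by rewrite mono_lt !iE -(patP _ _ _ pLs) mono_lt !vE !ltn_add2l.
have term (i : {ffun 'I_K.+1 -> 'I_n}) : i \in emb B K.+1 n ->
    (pat pi (L * s)%g i)%:R + (i == i0)%:R <= (pat pi s i)%:R :> R.
  move=> Hi; have [->|ne] := eqVneq i i0.
    have -> : pat pi s i0.
      apply/patP => r t; rewrite (patP _ _ _ ptau) (patP _ _ _ ps).
      by rewrite !comp_ffunE.
    rewrite (no_mono _ K.+1) ?add0r // ?i0E ?addn0 // /w; lia.
  rewrite addr0 ler_nat; case: (boolP (pat pi (L * s)%g i)) => //= pLi; rewrite lt0b.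
  (* By [no_mono] the occurrence avoids the middle third, the only place where [L] moves
     positions. *)
  rewrite -(@pat_ext _ _ pi (L * s)%g s i) // => r; rewrite permM; congr (s _).
  case: (boolP (i r \in codom (win q))) => [/codomP[x ix]|]; last exact: Lout.
  rewrite ix Lwin; congr (win q _); apply: Tout; apply/codomP => -[t xt].
  have irE : i r = (q * w + (K.+1 + t))%N :> nat by rewrite ix winE xt midE.
  have := full_emb r Hi; rewrite irE => E.
  have := ltn_ord r; have := ltn_ord t => t_lt r_lt.
  have := no_mono i (K.+1 + t - r)%N Hi; rewrite pLi => H.
  suff : true = false by [].
  apply: H; last by rewrite /w; lia.
  move: E; move: (q * w)%N (nat_of_ord (i ord0)) => a b E; lia.
apply: le_trans (ler_sum _ term).
rewrite big_split /= lerD2l (bigD1 i0) //= eqxx big1 ?addr0 // => i /andP[_ ne].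
by rewrite (negbTE ne).
Qed.

(** With [Y] as below, [E[X Y] >= N * c] and [E[Y ^+ 2] <= N], so [lam = c] yields [c ^+ 2 * N]. *)
Lemma var_ge_windows :
  (w`!%:R^-1) ^+ 2 * N%:R <= unif_var (@Nocc R K B pi n).
Proof.
have [T [tau [TE ptau Tmid Tout]]] := bump_ex.
pose p rho q (s : 'S_n) : R := (pat rho s (win q))%:R.
pose Y (s : 'S_n) : R := \sum_q (p tau q s - p (mono w) q s).
set c : R := w`!%:R^-1.
have mp rho q : unif_mean (p rho q) = c by apply: mean_pat1; exact: win_inj.
have mY : unif_mean Y = 0.
  by rewrite mean_sum big1 // => q _; rewrite meanB !mp subrr.
(* Distinct windows are disjoint, so their centred terms are uncorrelated; each diagonal term is at
   most 1. *)
have mYY : unif_mean (fun s => Y s * Y s) <= N%:R.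
  under eq_mean => s do rewrite /Y big_distrlr /=.
  rewrite mean_sum -[X in _ <= X%:R]card_ord -sumr_const; apply: ler_sum => q _.
  rewrite mean_sum (bigD1 q) //= big1 ?addr0 => [|q' ne].
    rewrite -[X in _ <= X](mean_cst (card_Sn_gt0 n)); apply: mean_le => s.
    by rewrite /p; case: (pat _ _ _); case: (pat _ _ _); rewrite /=; lra.
  have pp rho rho' : unif_mean (fun s => p rho q s * p rho' q' s) = c * c.
    by apply: mean_pat_disjoint; [exact: win_inj|exact: win_inj|apply: win_disjoint; rewrite eq_sym].
  under eq_mean => s do rewrite mulrBl !mulrBr.
  by rewrite !meanB !pp !subrr.
have mXY : N%:R * c <= unif_mean (fun s => Nocc R B pi s * Y s).
  under eq_mean => s do rewrite mulr_sumr.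
  rewrite mean_sum -{1}(card_ord N) -sumr_cst; apply: ler_sum => q _.
  have [L [Lwin Lout]] := perm_lift T (win_inj (q := q)).
  under eq_mean => s do rewrite mulrBr.
  (* Reindexing by [L] turns the event of a monotone window into that of a window ordered as [tau],
     so both means are taken on the same event and [Nocc_bump] compares them pointwise. *)
  rewrite meanB -[X in _ - X](mean_bij _ (mulgI L)) -meanB -(mp tau q).
  apply: mean_le => s; rewrite /p -TE pat_lift // -mulrBl.
  case: (boolP (pat tau s (win q))) => ps; rewrite ?mulr0 ?mulr1 //.
  by rewrite lerBrDl; apply: Nocc_bump TE ptau Tmid Tout Lwin Lout ps.
apply: le_trans (var_ge (@Nocc R K B pi n) c mY).
have c0 : 0 <= c by rewrite invr_ge0 ler0n.
have := ler_wpM2l (sqr_ge0 c) mYY; have := ler_wpM2l c0 mXY; lra.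
Qed.

End Windows.

Lemma var_ge_single :
  exists (Q N0 : nat) (c : R), [/\ (0 < Q)%N, 0 < c & forall N, (N0 <= N)%N ->
    c * (Q * N)%:R ^+ (2 * (blk B K).+1 - 1) <= unif_var (@Nocc R K B pi (Q * N))].
Proof.
exists w, 0%N, ((w`!%:R^-1) ^+ 2 / w%:R); split=> // [|N _].
  by rewrite divr_gt0 ?ltr0n // exprn_gt0 // invr_gt0 ltr0n fact_gt0.
rewrite B_full expr1 natrM mulrA divfK ?pnatr_eq0 //.
exact: var_ge_windows.
Qed.

End SingleBlock.

(** * Asymptotics of the variance *)

Section Occurrences.
Variables (R : realType) (K : nat) (pi : 'S_K.+1) (A : {set 'I_K}).

Definition adj_at : pred nat := fun x => [exists a in A, a == x :> nat].

Lemma adj_at_lt r : adj_at r -> (r < K)%N.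
Proof. by case/existsP => a /andP[_ /eqP <-]. Qed.

Lemma blocksE : @blocks K.+1 A = (blk adj_at K).+1.
Proof.
rewrite /blocks /blk -nadj_card subSn.
  rewrite (_ : [set x : 'I_K | adj_at x] = A) //.
  apply/setP => x; rewrite inE; apply/existsP/idP => [[a /andP[aA]]|xA].
    by rewrite val_eqE => /eqP <-.
  by exists x; rewrite xA eqxx.
by rewrite -[X in (_ <= X)%N]card_ord max_card.
Qed.

Lemma occurrencesE n (sigma : 'S_n) :
  (@occurrences K.+1 pi A n sigma)%:R = Nocc R adj_at pi sigma.
Proof.
rewrite /occurrences /Nocc -sum1_card natr_sum.
transitivity (\sum_(i in emb adj_at K.+1 n | pat pi sigma i) (1 : R)); last first.
  by rewrite big_mkcondr /=; apply: eq_bigr => i _; case: (pat _ _ _).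
apply: eq_bigl => i; rewrite inE /is_occurrence andbCA andbC inE -!andbA.
congr (_ && _); rewrite -[RHS]andbC -/(pat pi sigma i) andbC; congr (_ && _).
apply/forallP/forallP => H.
  move=> r; apply/forallP => s; apply/implyP => /andP[/existsP[a /andP[aA /eqP ar]] sr].
  have /implyP/(_ aA)/forallP/(_ r)/forallP/(_ s)/implyP := H a; apply.
  by rewrite -ar eqxx ar sr.
move=> a; apply/implyP => aA; apply/forallP => r; apply/forallP => s.
apply/implyP => /andP[/eqP ra sa]; have /forallP/(_ s)/implyP := H r; apply.
by rewrite ra sa andbT; apply/existsP; exists a; rewrite aA eqxx.
Qed.

End Occurrences.

Local Open Scope classical_set_scope.
Local Open Scope ring_scope.

Lemma cvg_ge_multiples (R : realType) (u : nat -> R) (L c : R) (Q N0 : nat) :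
  (0 < Q)%N -> u @ \oo --> L -> (forall N, (N0 <= N)%N -> c <= u (Q * N)%N) -> c <= L.
Proof.
move=> Q_gt0 uL uc; rewrite leNgt; apply/negP => Lc.
have [N1 _ HN1] := cvgr_lt _ uL _ Lc.
have := uc (maxn N0 N1) (leq_maxl _ _); rewrite leNgt => /negP; apply.
by apply: HN1 => /=; rewrite (leq_trans (leq_maxr N0 N1)) // leq_pmull.
Qed.

Theorem theorem4p1 (R : realType) (k : nat) (hk : (2 <= k)%N)
    (pi : 'S_k) (A : {set 'I_k.-1}) :
  exists C : R, 0 < C /\
    (fun n : nat =>
       unif_var (fun sigma : 'S_n => (occurrences pi A sigma)%:R : R)
         / (C * n%:R ^+ (2 * blocks A - 1)%N)) @ \oo --> (1 : R).
Proof.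
case: k => [//|K] in hk pi A *; rewrite /= in A *.
set B := adj_at A; set D := (2 * (blk B K).+1 - 1)%N.
have [L VL] := converges_var R pi (@adj_at_lt K A).
have [Q [N0 [c [Q_gt0 c_gt0 lower]]]] : exists (Q N0 : nat) (c : R),
    [/\ (0 < Q)%N, 0 < c & forall N, (N0 <= N)%N ->
      c * (Q * N)%:R ^+ D <= unif_var (@Nocc R K B pi (Q * N))].
  by have [b0|/var_ge_multi] := posnP (blk B K); [exact: var_ge_single|exact].
have L_gt0 : 0 < L.
  apply: lt_le_trans c_gt0 _.
  (* The threshold [N0.+1] keeps [N] positive, so that the power of [Q * N] may be divided out. *)
  apply: (@cvg_ge_multiples _ _ L c Q N0.+1 Q_gt0 VL) => N N_ge.
  rewrite ler_pdivlMr; first by apply: lower; exact: ltnW.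
  by rewrite exprn_gt0 // ltr0n muln_gt0 Q_gt0 (leq_trans _ N_ge).
exists L; split=> //.
have -> : (fun n : nat => unif_var (fun sigma : 'S_n => (@occurrences K.+1 pi A n sigma)%:R : R)
         / (L * n%:R ^+ (2 * @blocks K.+1 A - 1)%N)) =
    (fun n => unif_var (@Nocc R K B pi n) / n%:R ^+ D * L^-1).
  apply/funext => n; rewrite blocksE -/B -/D invfM [L^-1 * _]mulrC mulrA.
  congr (_ * _ * _); congr unif_var; apply/funext => s; exact: occurrencesE.
have := cvgM VL (cvg_cst (L^-1)).
by rewrite mulfV ?lt0r_neq0 //; apply.
Qed.
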